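(* For any fixed $d\ge 2$ and any rational $r\ge 1$, the set of constants $\beta_H^d$, as $H$ ranges over connected graphs with edge density $\frac{|E(H)|}{|V(H)|}=r$, is infinite; that is, there are infinitely many distinct constants $\beta_H^d$ over such $H$.
   Context: Let $x_1,x_2,\dots$ be independent uniformly random points of $[0,1]^d$ and $\mathcal{X}_n=\{x_1,\dots,x_n\}$. All lengths are Euclidean, and graphs are finite and simple. Given a fixed graph $H$ on $k$ vertices, an $H$-factor of a finite set of points $X$ is a set of edges on $X$ isomorphic to $\lfloor |X|/k\rfloor$ vertex-disjoint copies of $H$. $H\mathrm{F}(X)$ is the minimum total edge length of an $H$-factor of $X$. $\beta_H^d$ is the constant such that $H\mathrm{F}(\mathcal{X}_n)/n^{(d-1)/d}\to\beta_H^d$ almost surely (which exists). *)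

(* Defs.v *)
From HB Require Import structures.
From mathcomp Require Import all_boot all_order all_algebra finmap.
From mathcomp Require Import all_classical all_reals all_analysis.

Set Implicit Arguments.
Unset Strict Implicit.
Unset Printing Implicit Defensive.

Import Order.TTheory GRing.Theory Num.Theory.
Import numFieldNormedType.Exports.

Local Open Scope classical_set_scope.
Local Open Scope ring_scope.

Record sgraph := SGraph {
  vertex : finType;
  adj : rel vertex;
  adj_sym : symmetric adj;
  adj_irr : irreflexive adj }.

Definition edges (G : sgraph) : {set {set vertex G}} :=
  [set e : {set vertex G} |
    [exists u, exists v, adj u v && (e == [set u; v])]]%SET.

Definition connected_graph (G : sgraph) : Prop :=
  (0 < #|vertex G|)%N /\ forall u v : vertex G, connect (@adj G) u v.

Definition edge_density (G : sgraph) : rat :=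
  #|edges G|%:R / #|vertex G|%:R.

Section DisjointCopies.
Variables (m : nat) (H : sgraph).

Definition copies_adj : rel ('I_m * vertex H) :=
  [rel p q | (p.1 == q.1) && adj p.2 q.2].

Lemma copies_sym : symmetric copies_adj.
Proof. by move=> p q; rewrite /copies_adj /= eq_sym adj_sym. Qed.

Lemma copies_irr : irreflexive copies_adj.
Proof. by move=> p; rewrite /copies_adj /= adj_irr andbF. Qed.

Definition copies : sgraph := SGraph copies_sym copies_irr.
End DisjointCopies.

Section Factor.
Variables (R : realType) (d : nat).
Implicit Types (X : {fset d.-tuple R}) (H : sgraph).

Definition eucl_dist (x y : d.-tuple R) : R :=
  Num.sqrt (\sum_(j < d) (tnth x j - tnth y j) ^+ 2).

(* [F] is the image of the edge set of |X| %/ |V(H)| disjoint copies of [H]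
   under an injection of their vertices into [X]; the remaining points of [X],
   fewer than |V(H)|, are left uncovered. *)
Definition is_factor H X (F : {set {set X}}) : Prop :=
  let mH := copies (#|` X| %/ #|vertex H|) H in
  exists2 f : vertex mH -> X, injective f &
    F = [set f @: e | e : {set vertex mH} in edges mH]%SET.

(* On a two-point set {x, y} this diameter is the distance from x to y. *)
Definition edge_length X (e : {set X}) : R :=
  \big[Num.max/0]_(p in finset.setX e e) eucl_dist (val p.1) (val p.2).

Definition total_length X (F : {set {set X}}) : R :=
  \sum_(e in F) edge_length e.

(* The set of lengths is finite and nonempty, so the infimum is a minimum. *)
Definition HF H X : R :=
  inf [set total_length F | F in [set F : {set {set X}} | is_factor H F]].
End Factor.

Section RandomPoints.
Variables (R : realType) (disp : measure_display) (Omega : measurableType disp).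
Variables (P : probability Omega R) (d : nat).
Variable x : nat -> {RV P >-> d.-tuple R}.

Definition mutually_independent : Prop :=
  forall (J : {fset nat}) (B : nat -> set (d.-tuple R)),
    (forall i, measurable (B i)) ->
    P (\bigcap_(i in [set` J]) (x i @^-1` B i)) =
      (\prod_(i <- J) P (x i @^-1` B i))%E.

(* The uniform law on the cube is the d-fold product of the uniform law on
   [0, 1], which is determined by its values on measurable rectangles. *)
Definition uniform_on_cube (Y : {RV P >-> d.-tuple R}) : Prop :=
  forall B : 'I_d -> set (measurableTypeR R),
    (forall j, measurable (B j)) ->
    distribution P Y [set t | forall j, B j (tnth t j)] =
      (\prod_(j < d) uniform_prob (@ltr01 R) (B j))%E.

Definition points (n : nat) (w : Omega) : {fset d.-tuple R} :=
  [fset x (nat_of_ord i) w | i in 'I_n]%fset.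

Definition is_beta (H : sgraph) (b : R) : Prop :=
  \forall w \ae P,
    HF H (points n w) / (n%:R `^ (d.-1%:R / d%:R)) @[n --> \oo] --> b.
End RandomPoints.

(* Main.v *)
(* Let [H] be a star on [k] vertices with extra edges. The minimal cost [L] of
   an [H]-factor satisfies [L X <= C |X|^((d-1)/d)] (traverse thin rods), is
   subadditive over a partition of the cube up to an error of boundary order,
   and is smooth: adding or deleting points may only break the copies which
   they meet, and the points so freed can be covered again within the growth
   bound. After rounding to a fine grid every expectation is a finite average.
   Subadditivity makes the normalized means converge; smoothness and the
   Efron-Stein inequality, through a Lipschitz regularization in the Hamming
   metric, make the deviation probabilities summable along the sample sizes
   [j ^ (2 d)], whence almost sure convergence. Finally [k - 1] leaves cannot
   all lie close to their centre, because few points lie in crowded cells; so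
   the limit tends to infinity with [k], and at a given density [r >= 1] it
   takes infinitely many values. *)
Require Import Defs.
From mathcomp Require Import all_boot all_order all_algebra finmap.
From mathcomp Require Import all_classical all_reals all_analysis.
From mathcomp Require Import ring lra zify.
Import Order.TTheory GRing.Theory Num.Theory.
Import numFieldNormedType.Exports.
Local Open Scope classical_set_scope.
Local Open Scope ring_scope.
Set Implicit Arguments.
Unset Strict Implicit.
Unset Printing Implicit Defensive.

(** * Finite averages *)

(** The cost is not Lipschitz in the number of changed points: in dimension [d.+1] the bound for h
    changes is a constant times M^d + h/M, for every positive integer M. Leaving M free avoids real
    powers; each application chooses its own M. The additive M^d is the obstacle to a direct
    variance bound and forces the regularization. Randomness enters only through finite words of
    grid cells. The resolution grows with the sample size, fast enough that rounding is negligible,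
    and the probability space is reached through upper bounds for events about the cells of the
    first n points. A cube splits evenly into a (d+1)-th power of subcubes, so subadditivity
    compares an index T with its multiples i T only; consecutive indices are compared by smoothness,
    and so are sample sizes between two consecutive terms of the subsequence. Constants of different
    graphs are never compared with each other. For the given density, graphs are built whose
    constant exceeds any prescribed bound, and a finite set of reals is bounded. *)

Section Hamming.
Variable T : eqType.

Fixpoint hamming (s t : seq T) : nat :=
  match s, t with
  | x :: s', y :: t' => (x != y) + hamming s' t'
  | _, _ => 0
  end.

Lemma hammingxx s : hamming s s = 0%N.
Proof. by elim: s => //= x s ->; rewrite eqxx. Qed.

Lemma hamming_sym s t : hamming s t = hamming t s.
Proof. by elim: s t => [|x s IH] [|y t] //=; rewrite eq_sym IH. Qed.

Lemma hamming_triangle s t u : size s = size t -> size t = size u ->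
  (hamming s u <= hamming s t + hamming t u)%N.
Proof.
elim: s t u => [|x s IH] [|y t] [|z u] //= [st] [tu].
have := IH _ _ st tu; case: (eqVneq x y) => [->|xy] /=; first by lia.
by case: (x != z); lia.
Qed.

End Hamming.

Section Average.
Variables (R : realFieldType).

Definition avg (G : finType) (f : G -> R) : R := (\sum_g f g) / #|G|%:R.

(** This is the expectation of [F] on a word of [n] independent uniform letters. The recursion makes
    conditioning on the first letter a computation; [expect_tuple] recovers the average over all
    words. *)
Fixpoint expect (G : finType) (n : nat) (F : seq G -> R) : R :=
  if n is n'.+1 then avg (fun g => expect n' (fun s => F (g :: s))) else F [::].

Section OneType.
Variables (G : finType) (hG : (0 < #|G|)%N).

Let card_neq0 : #|G|%:R != 0 :> R.
Proof. by rewrite pnatr_eq0 -lt0n. Qed.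

Lemma eq_avg (f g : G -> R) : f =1 g -> avg f = avg g.
Proof. by move=> fg; congr (_ / _); apply: eq_bigr. Qed.

Lemma avg_le (f g : G -> R) : (forall x, f x <= g x) -> avg f <= avg g.
Proof.
by move=> fg; rewrite ler_wpM2r ?invr_ge0 ?ler0n //; apply: ler_sum.
Qed.

Lemma avg_cst (c : R) : avg (fun _ : G => c) = c.
Proof. by rewrite /avg sumr_const -[c *+ _]mulr_natr mulfK. Qed.

Lemma avgD (f g : G -> R) : avg (fun x => f x + g x) = avg f + avg g.
Proof. by rewrite /avg big_split mulrDl. Qed.

Lemma avgZ (c : R) (f : G -> R) : avg (fun x => c * f x) = c * avg f.
Proof. by rewrite /avg -mulr_sumr mulrA. Qed.

Lemma avg_delta (Q : G) (u v : R) :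
  avg (fun a => if a == Q then u else v) =
  #|G|%:R^-1 * u + (1 - #|G|%:R^-1) * v.
Proof.
rewrite (eq_avg (g := fun a => v + (u - v) * (a == Q)%:R)); last first.
  by move=> a; case: eqP => _; rewrite ?mulr1 ?mulr0; ring.
rewrite avgD avg_cst avgZ /avg -natr_sum (bigD1 Q) //= eqxx big1 => [|a /negbTE -> //].
by rewrite addn0 /=; ring.
Qed.

(** The deviation of [f x] from the mean is an average of differences [f x - f y], so it is at most
    [K], and so is its root mean square. *)
Lemma avg_var (f : G -> R) (K : R) :
  (forall x y, `|f x - f y| <= K) ->
  avg (fun x => f x ^+ 2) <= avg f ^+ 2 + K ^+ 2.
Proof.
move=> hf; set m := avg f.
have hm x : (f x - m) ^+ 2 <= K ^+ 2.
  rewrite -real_normK ?num_real // ler_pXn2r ?nnegrE ?normr_ge0 //; last first.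
    by rewrite (le_trans _ (hf x x)) ?normr_ge0.
  have -> : f x - m = avg (fun y => f x + -1 * f y).
    by rewrite avgD avg_cst avgZ mulN1r.
  rewrite ler_norml -(avg_cst (- K)) -[X in _ && (_ <= X)]avg_cst.
  by apply/andP; split; apply: avg_le => y;
    have := hf x y; rewrite ler_norml => /andP[? ?]; lra.
have -> : avg (fun x => f x ^+ 2) =
    m ^+ 2 + avg (fun x => (f x - m) ^+ 2).
  rewrite [in RHS](eq_avg (g := fun x => f x ^+ 2 + (- (2 * m) * f x + m ^+ 2))).
    by rewrite avgD avgD avgZ avg_cst -/m; ring.
  by move=> x; ring.
by rewrite lerD2l -[leRHS]avg_cst; apply: avg_le.
Qed.

Lemma eq_expect n (F F' : seq G -> R) :
  (forall s, size s = n -> F s = F' s) -> expect n F = expect n F'.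
Proof.
elim: n F F' => [|n IH] F F' FF' /=; first exact: FF'.
by apply: eq_avg => g; apply: IH => s hs; apply: FF'; rewrite /= hs.
Qed.

Lemma expect_le n (F F' : seq G -> R) :
  (forall s, size s = n -> F s <= F' s) -> expect n F <= expect n F'.
Proof.
elim: n F F' => [|n IH] F F' FF' /=; first exact: FF'.
by apply: avg_le => g; apply: IH => s hs; apply: FF'; rewrite /= hs.
Qed.

Lemma expect_cst n (c : R) : expect n (fun _ : seq G => c) = c.
Proof.
by elim: n => //= n IH; rewrite -[RHS]avg_cst; apply: eq_avg.
Qed.

Lemma expectD n (F F' : seq G -> R) :
  expect n (fun s => F s + F' s) = expect n F + expect n F'.
Proof.
elim: n F F' => //= n IH F F'; rewrite -avgD; apply: eq_avg => g.
exact: IH.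
Qed.

Lemma expectZ n (c : R) (F : seq G -> R) : expect n (fun s => c * F s) = c * expect n F.
Proof.
elim: n F => //= n IH F; rewrite -avgZ; apply: eq_avg => g; exact: IH.
Qed.

Lemma expect_sum n (I : Type) (r : seq I) (F : I -> seq G -> R) :
  expect n (fun s => \sum_(i <- r) F i s) = \sum_(i <- r) expect n (F i).
Proof.
elim: r => [|i r IH].
  rewrite big_nil -[RHS](expect_cst n).
  by apply: eq_expect => s _; rewrite big_nil.
rewrite big_cons -IH -expectD.
by apply: eq_expect => s _; rewrite big_cons.
Qed.

Lemma expect_dist n (F F' : seq G -> R) (e : R) :
  (forall s, size s = n -> `|F s - F' s| <= e) -> `|expect n F - expect n F'| <= e.
Proof.
move=> h; have hc := expect_cst n e.
rewrite ler_distl lerBlDr -{1 2}hc -!expectD.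
by apply/andP; split; apply: expect_le => s /h; rewrite ler_distl => /andP[]; lra.
Qed.

Lemma expect_cat m n (F : seq G -> R) :
  expect (m + n) F = expect m (fun s => expect n (fun t => F (s ++ t))).
Proof.
elim: m F => //= m IH F; apply: eq_avg => g; exact: IH.
Qed.

Definition lipschitz n (K : R) (F : seq G -> R) :=
  forall s t, size s = n -> size t = n -> `|F s - F t| <= K * (hamming s t)%:R.

(* Efron-Stein: the variance accumulates at most [K ^ 2] per coordinate. *)
Lemma expect_var n (K : R) (F : seq G -> R) : 0 <= K -> lipschitz n K F ->
  expect n (fun s => F s ^+ 2) <= expect n F ^+ 2 + n%:R * K ^+ 2.
Proof.
move=> K0; elim: n F => [|n IH] F hF /=; first by rewrite mul0r addr0.
have h1 g : expect n (fun s => F (g :: s) ^+ 2) <=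
    expect n (fun s => F (g :: s)) ^+ 2 + n%:R * K ^+ 2.
  apply: (IH (fun s => F (g :: s))) => s t hs ht.
  by have := hF (g :: s) (g :: t); rewrite /= hs ht eqxx; apply.
apply: (le_trans (avg_le h1)); rewrite avgD avg_cst.
have -> : n.+1%:R * K ^+ 2 = K ^+ 2 + n%:R * K ^+ 2 by rewrite -natr1; ring.
rewrite addrA lerD2r; apply: avg_var => x y.
apply: expect_dist => s hs; apply: (le_trans (hF _ _ _ _)); rewrite /= ?hs //.
rewrite /= hammingxx addn0 -[leRHS]mulr1 ler_wpM2l //.
by case: (x != y).
Qed.

Lemma expect_chebyshev n (K e : R) (F : seq G -> R) :
  0 <= K -> 0 < e -> lipschitz n K F ->
  expect n (fun s => (e < `|F s - expect n F|)%R%:R) <= n%:R * K ^+ 2 / e ^+ 2.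
Proof.
move=> K0 e0 hF; set m := expect n F.
rewrite ler_pdivlMr ?exprn_gt0 // mulrC -expectZ.
have h : expect n (fun s => (F s - m) ^+ 2) <= n%:R * K ^+ 2.
  have -> : expect n (fun s => (F s - m) ^+ 2) =
      expect n (fun s => F s ^+ 2 + (- (2 * m) * F s + m ^+ 2)).
    by apply: eq_expect => s _; ring.
  by rewrite expectD expectD expectZ expect_cst -/m; have := expect_var K0 hF; rewrite -/m; lra.
apply: le_trans h; apply: expect_le => s _.
case: ltP => h; last by rewrite mulr0 sqr_ge0.
by rewrite mulr1 -[leRHS]real_normK ?num_real // ler_pXn2r ?nnegrE ?normr_ge0 ?ltW.
Qed.

(** Second moment of a binomial variable about [- y]. The shift makes the induction work: a hit in
    the first letter turns [y] into [1 + y]. *)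
Lemma expect_count_mem n (Q : G) (y : R) :
  expect n (fun s => ((count_mem Q s)%:R + y) ^+ 2) =
  n%:R * #|G|%:R^-1 * (1 - #|G|%:R^-1) + (n%:R * #|G|%:R^-1 + y) ^+ 2.
Proof.
elim: n y => [|n IH] y /=; first by ring.
set p := #|G|%:R^-1.
rewrite (eq_avg (g := fun a => if a == Q then
    n%:R * p * (1 - p) + (n%:R * p + (1 + y)) ^+ 2 else
    n%:R * p * (1 - p) + (n%:R * p + y) ^+ 2)).
  by rewrite avg_delta -natr1 -/p; ring.
move=> a; case: eqVneq => _; rewrite -IH; apply: eq_expect => s _ //=.
by rewrite natrD addrA [_ + 1]addrC.
Qed.

Lemma expect_mem n (g : G) :
  expect n (fun s => (g \in s)%:R) <= n%:R / #|G|%:R.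
Proof.
elim: n => [|n IH] /=; first by rewrite mul0r.
apply: (@le_trans _ _ (avg (fun a : G => (if a == g then 1 else 0) + n%:R / #|G|%:R))).
  apply: avg_le => a; case: eqVneq => [->|ag].
    apply: (@le_trans _ _ 1); last by rewrite lerDl divr_ge0.
    rewrite -[leRHS](expect_cst n); apply: expect_le => s _; by rewrite lern1 leq_b1.
  rewrite add0r; apply: le_trans IH; apply: expect_le => s _.
  by rewrite inE eq_sym (negbTE ag).
by rewrite avgD avg_delta avg_cst -natr1; lra.
Qed.

(** The birthday bound: the first letter reappears among the other [n] with probability at most
    n/|G|. It will show that the random points are almost surely distinct. *)
Lemma expect_not_uniq n :
  expect n (fun s : seq G => (~~ uniq s)%:R) <= n%:R ^+ 2 / #|G|%:R.
Proof.
elim: n => [|n IH] /=; first by rewrite expr0n mul0r.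
apply: (@le_trans _ _ (avg (fun g : G =>
    n%:R / #|G|%:R + n%:R ^+ 2 / #|G|%:R))).
  apply: avg_le => g; apply: le_trans (lerD (expect_mem n g) IH).
  by rewrite -expectD; apply: expect_le => s _; case: (g \in s); case: (uniq s);
    rewrite /= ?addr0 ?add0r // lerDl ler01.
rewrite avg_cst -mulrDl ler_wpM2r ?invr_ge0 ?ler0n // -natr1.
by have := ler0n R n; nra.
Qed.

Lemma expect_tuple n (F : seq G -> R) :
  expect n F = (\sum_(t : n.-tuple G) F t) / #|G|%:R ^+ n.
Proof.
elim: n F => [|n IH] F /=.
  rewrite (big_pred1 [tuple]) ?expr0 ?divr1 // => t; apply/esym/eqP; exact: tuple0.
rewrite (eq_avg (g := fun g =>
  (#|G|%:R ^+ n)^-1 * \sum_(t : n.-tuple G) F (g :: t))); last first.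
  by move=> g; rewrite IH mulrC.
have -> : \sum_(t : n.+1.-tuple G) F t = \sum_g \sum_(t : n.-tuple G) F (g :: t).
  rewrite pair_big /= (reindex (fun p : G * n.-tuple G => cons_tuple p.1 p.2)) //.
  exists (fun t : n.+1.-tuple G => (thead t, behead_tuple t)) => [[g t] _|t _] /=.
    by rewrite theadE; congr (_, _); apply/val_inj.
  by apply/val_inj; rewrite /= [in RHS](tuple_eta t).
by rewrite avgZ /avg exprS invfM; ring.
Qed.
End OneType.

Lemma avg_prod (A B : finType) (f : A * B -> R) :
  avg f = avg (fun a => avg (fun b => f (a, b))).
Proof.
rewrite /avg card_prod natrM invfM mulr_suml.
rewrite (eq_bigr (fun p => f (p.1, p.2) / (#|A|%:R * #|B|%:R))); last first.
  by case=> a b _; rewrite invfM.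
rewrite -(pair_big xpredT xpredT (fun a b => f (a, b) / (#|A|%:R * #|B|%:R))) /=.
rewrite mulr_suml; apply: eq_bigr => a _.
rewrite -mulr_suml invfM -!mulrA; congr (_ * _); exact: mulrC.
Qed.

Lemma expect_bij (A B : finType) (h : A -> B) n (F : seq B -> R) : bijective h ->
  expect n F = expect n (fun s => F (map h s)).
Proof.
move=> bij_h; have hc : #|A| = #|B| by exact: bij_eq_card bij_h.
elim: n F => //= n IH F.
rewrite /avg -hc; congr (_ / _).
rewrite (reindex h) /=; last exact: onW_bij.
by apply: eq_bigr => a _; rewrite IH.
Qed.

Lemma expect_fst (A B : finType) n (F : seq A -> R) : (0 < #|B|)%N ->
  expect n (fun s : seq (A * B) => F (map fst s)) = expect n F.
Proof.
move=> hB; elim: n F => //= n IH F; rewrite avg_prod.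
apply: eq_avg => a; rewrite -[RHS](avg_cst hB); apply: eq_avg => b; exact: IH.
Qed.

(* Given the first coordinates, the second coordinates of the pairs lying over
   [Q] are again a uniform sample, of size the number of hits of [Q]. *)
Lemma expect_fiber (A B : finType) n (Q : A) (F : seq B -> R) : (0 < #|B|)%N ->
  expect n (fun s : seq (A * B) => F [seq p.2 | p <- s & p.1 == Q]) =
  expect n (fun q : seq A => expect (count_mem Q q) F).
Proof.
move=> hB; elim: n F => //= n IH F; rewrite avg_prod; apply: eq_avg => a /=.
case: (a == Q) => /=; last first.
  by rewrite IH (avg_cst hB).
rewrite (eq_avg (g := fun b => expect n (fun q : seq A =>
  expect (count_mem Q q) (fun s => F (b :: s))))); last first.
  by move=> b; rewrite -IH.
rewrite /avg -expect_sum; last by apply/card_gt0P; exists a.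
transitivity (#|B|%:R^-1 *
  expect n (fun q => \sum_(b : B) expect (count_mem Q q) (fun s => F (b :: s)))).
  exact: mulrC.
rewrite -expectZ; apply: eq_expect => q _.
exact: mulrC.
Qed.
End Average.

(** * Factors of lists of points *)

Section EuclDist.
Variables (R : realType) (d : nat).
Implicit Types x y z : d.-tuple R.

Lemma eucl_dist_ge0 x y : 0 <= eucl_dist x y.
Proof. exact: sqrtr_ge0. Qed.

Lemma eucl_distC x y : eucl_dist x y = eucl_dist y x.
Proof.
by congr Num.sqrt; apply: eq_bigr => j _; rewrite -sqrrN opprB.
Qed.

Lemma eucl_distxx x : eucl_dist x x = 0.
Proof.
by rewrite /eucl_dist big1 ?sqrtr0 // => j _; rewrite subrr expr0n.
Qed.

Let sum_sqr_ge0 (n : nat) (a : 'I_n -> R) : 0 <= \sum_j a j ^+ 2.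
Proof. by apply: sumr_ge0 => j _; apply: sqr_ge0. Qed.

(** Lagrange's identity: the gap, doubled, is the sum of the squares of a_i b_j - a_j b_i. *)
Lemma sum_cauchy_schwarz (n : nat) (a b : 'I_n -> R) :
  (\sum_j a j * b j) ^+ 2 <= (\sum_j a j ^+ 2) * (\sum_j b j ^+ 2).
Proof.
have : 0 <= \sum_i \sum_j (a i * b j - a j * b i) ^+ 2.
  by apply: sumr_ge0 => i _; apply: sum_sqr_ge0.
have -> : \sum_i \sum_j (a i * b j - a j * b i) ^+ 2 =
    \sum_i \sum_j (a i ^+ 2 * b j ^+ 2 + b i ^+ 2 * a j ^+ 2
                   - 2 * ((a i * b i) * (a j * b j))).
  by apply: eq_bigr => i _; apply: eq_bigr => j _; ring.
have -> : \sum_i \sum_j (a i ^+ 2 * b j ^+ 2 + b i ^+ 2 * a j ^+ 2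
                   - 2 * ((a i * b i) * (a j * b j))) =
  2 * ((\sum_j a j ^+ 2) * (\sum_j b j ^+ 2) - (\sum_j a j * b j) ^+ 2).
  under eq_bigr => i _ do
    rewrite sumrB big_split /= -!mulr_sumr.
  rewrite sumrB big_split /= -mulr_sumr -!mulr_suml; ring.
lra.
Qed.

Lemma sqrt_sum_sqrD (n : nat) (a b : 'I_n -> R) :
  Num.sqrt (\sum_j (a j + b j) ^+ 2) <=
  Num.sqrt (\sum_j a j ^+ 2) + Num.sqrt (\sum_j b j ^+ 2).
Proof.
set A := \sum_j a j ^+ 2; set B := \sum_j b j ^+ 2.
have A0 : 0 <= A by exact: sum_sqr_ge0.
have B0 : 0 <= B by exact: sum_sqr_ge0.
have AB0 : 0 <= Num.sqrt A + Num.sqrt B by rewrite addr_ge0 ?sqrtr_ge0.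
rewrite -[leRHS]ger0_norm // -sqrtr_sqr ler_sqrt ?sqr_ge0 //.
rewrite sqrrD !sqr_sqrtr // -sqrtrM //.
have -> : \sum_j (a j + b j) ^+ 2 = A + 2 * (\sum_j a j * b j) + B.
  rewrite mulr_sumr -!big_split /=; apply: eq_bigr => j _; ring.
rewrite lerD2r lerD2l -[leRHS]mulr_natl ler_wpM2l //.
apply: le_trans (ler_norm _) _.
by rewrite -sqrtr_sqr ler_sqrt ?mulr_ge0 // sum_cauchy_schwarz.
Qed.

Lemma eucl_dist_triangle y x z :
  eucl_dist x z <= eucl_dist x y + eucl_dist y z.
Proof.
rewrite /eucl_dist.
have -> : \sum_(j < d) (tnth x j - tnth z j) ^+ 2 =
    \sum_(j < d) ((tnth x j - tnth y j) + (tnth y j - tnth z j)) ^+ 2.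
  by apply: eq_bigr => j _; congr (_ ^+ 2); ring.
exact: sqrt_sum_sqrD.
Qed.

Lemma sqrt_sum_sqr_le (n : nat) (a : 'I_n -> R) :
  Num.sqrt (\sum_j a j ^+ 2) <= \sum_j `|a j|.
Proof.
elim: n a => [|n IH] a; first by rewrite !big_ord0 sqrtr0.
rewrite !big_ord_recl; set u := \sum_(i < n) _; set v := \sum_(i < n) _.
have u0 : 0 <= u by exact: sum_sqr_ge0.
have uv : Num.sqrt u <= v by exact: IH.
have v0 : 0 <= v by exact: le_trans (sqrtr_ge0 _) uv.
have {}uv : u <= v ^+ 2 by rewrite -(sqr_sqrtr u0) ler_pXn2r ?nnegrE ?sqrtr_ge0.
rewrite -[leRHS]ger0_norm ?addr_ge0 // -sqrtr_sqr ler_sqrt ?sqr_ge0 //.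
rewrite sqrrD real_normK ?num_real // -addrA lerD2l.
by apply: le_trans uv _; rewrite lerDr mulrn_wge0 ?mulr_ge0.
Qed.

Lemma eucl_dist_le_sum x y :
  eucl_dist x y <= \sum_(j < d) `|tnth x j - tnth y j|.
Proof.
exact: (sqrt_sum_sqr_le (fun j => tnth x j - tnth y j)).
Qed.

Lemma eucl_dist_ge_coord x y (j : 'I_d) :
  `|tnth x j - tnth y j| <= eucl_dist x y.
Proof.
rewrite -sqrtr_sqr ler_sqrt; last exact: sum_sqr_ge0.
by rewrite (bigD1 j) //= lerDl sumr_ge0 // => i _; exact: sqr_ge0.
Qed.

Lemma eucl_dist_scale (c : R) x y x' y' : 0 <= c ->
  (forall j, tnth x j - tnth y j = c * (tnth x' j - tnth y' j)) ->
  eucl_dist x y = c * eucl_dist x' y'.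
Proof.
move=> c0 h; rewrite /eucl_dist.
under eq_bigr => j _ do rewrite h exprMn.
by rewrite -mulr_sumr sqrtrM ?sqr_ge0 // sqrtr_sqr ger0_norm.
Qed.
End EuclDist.

Section FactorCost.
Variables (R : realType) (d k : nat) (E : rel 'I_k).
Local Notation pt := (d.-tuple R).

Definition origin : pt := [tuple 0 | _ < d].

(** The position in the chunk is the vertex of the copy of the graph. The condition [p.1 < p.2]
    counts each undirected edge once. *)
Definition chunk_cost (c : seq pt) : R :=
  \sum_(p : 'I_k * 'I_k | (p.1 < p.2)%N && E p.1 p.2)
    eucl_dist (nth origin c p.1) (nth origin c p.2).

Definition total_cost (cs : seq (seq pt)) : R := \sum_(c <- cs) chunk_cost c.

Lemma chunk_cost_ge0 c : 0 <= chunk_cost c.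
Proof. by apply: sumr_ge0 => p _; apply: eucl_dist_ge0. Qed.

Lemma total_cost_ge0 cs : 0 <= total_cost cs.
Proof. by apply: sumr_ge0 => c _; apply: chunk_cost_ge0. Qed.

Lemma total_cost_cat cs cs' :
  total_cost (cs ++ cs') = total_cost cs + total_cost cs'.
Proof. exact: big_cat. Qed.

Let sum_pairs_le (f : 'I_k * 'I_k -> R) (b : R) : 0 <= b ->
  (forall p, f p <= b) ->
  \sum_(p : 'I_k * 'I_k | (p.1 < p.2)%N && E p.1 p.2) f p <= k%:R ^+ 2 * b.
Proof.
move=> b0 hf; apply: (@le_trans _ _ (\sum_(p : 'I_k * 'I_k) b)).
  rewrite big_mkcond /=; apply: ler_sum => p _.
  by case: ifP => // _.
by rewrite sumr_const card_prod card_ord -[leLHS]mulr_natl natrM expr2.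
Qed.

Lemma chunk_cost_le (c : seq pt) (b : R) : 0 <= b -> size c = k ->
  (forall x y, x \in c -> y \in c -> eucl_dist x y <= b) ->
  chunk_cost c <= k%:R ^+ 2 * b.
Proof.
by move=> b0 hc hb; apply: sum_pairs_le => // p; apply: hb; rewrite mem_nth ?hc.
Qed.

Lemma chunk_cost_map (T : eqType) (f g : T -> pt) (h : R) (c : seq T) :
  0 <= h -> size c = k -> (forall x, x \in c -> eucl_dist (f x) (g x) <= h) ->
  chunk_cost (map f c) <= chunk_cost (map g c) + k%:R ^+ 2 * (2 * h).
Proof.
move=> h0 hc hfg; rewrite -lerBlDl -sumrB; apply: sum_pairs_le.
  by rewrite mulr_ge0.
case=> u v /=; case: c hc hfg => [|x0 c] hc hfg.
  by move: (ltn_ord u); rewrite -[X in (_ < X)%N]hc.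
rewrite !(nth_map x0) ?hc //.
set a := nth x0 _ u; set b := nth x0 _ v.
have ha : eucl_dist (f a) (g a) <= h by apply: hfg; rewrite mem_nth ?hc.
have hb : eucl_dist (f b) (g b) <= h by apply: hfg; rewrite mem_nth ?hc.
have := eucl_dist_triangle (g a) (f a) (f b).
have := eucl_dist_triangle (g b) (g a) (f b).
rewrite [eucl_dist (g b) (f b)]eucl_distC; lra.
Qed.

Lemma chunk_cost_scale (T : Type) (f g : T -> pt) (r : R) (c : seq T) :
  0 <= r -> size c = k ->
  (forall x y, eucl_dist (f x) (f y) = r * eucl_dist (g x) (g y)) ->
  chunk_cost (map f c) = r * chunk_cost (map g c).
Proof.
move=> r0 hc hfg; rewrite /chunk_cost mulr_sumr; apply: eq_bigr => -[u v] _ /=.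
case: c hc => [|x0 c] hc; first by move: (ltn_ord u); rewrite -[X in (_ < X)%N]hc.
by rewrite !(nth_map x0) ?hc.
Qed.

(* A factor of a list of points is a reordering of it into chunks of length
   [k], one per copy of the graph, followed by fewer than [k] uncovered
   points. *)
Definition factor_costs (s : seq pt) : set R :=
  [set c | exists cs rest, [/\ perm_eq s (flatten cs ++ rest),
     all (fun c => size c == k) cs, (size rest < k)%N & c = total_cost cs]].

Definition min_cost (s : seq pt) : R := inf (factor_costs s).

(** Relaxed factors: up to [rho] points may stay uncovered, and [c] is only an upper bound for the
    cost. Unlike true factors, these are stable under concatenation and under deletion of points. *)
Definition partial_factor (s : seq pt) (c : R) (rho : nat) : Prop :=
  exists cs rest, [/\ perm_eq s (flatten cs ++ rest),
     all (fun c => size c == k) cs, (size rest <= rho)%N & total_cost cs <= c].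

Lemma factor_costs_lbound s : lbound (factor_costs s) 0.
Proof. by move=> c [cs [rest [_ _ _ ->]]]; apply: total_cost_ge0. Qed.

Lemma factor_costs_perm s s' : perm_eq s s' -> factor_costs s = factor_costs s'.
Proof.
move=> ss'; apply/seteqP; split=> c [cs [rest [h1 h2 h3 h4]]]; exists cs, rest;
  split=> //.
  by rewrite -(permPl ss').
by rewrite (permPl ss').
Qed.

Lemma min_cost_perm s s' : perm_eq s s' -> min_cost s = min_cost s'.
Proof. by move=> ss'; rewrite /min_cost (factor_costs_perm ss'). Qed.

Lemma size_flatten_chunks (cs : seq (seq pt)) :
  all (fun c => size c == k) cs -> size (flatten cs) = (size cs * k)%N.
Proof.
by elim: cs => //= c cs IH /andP[/eqP hc /IH]; rewrite size_cat hc => ->.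
Qed.

Hypothesis k_gt0 : (0 < k)%N.

Lemma factor_costs_nonempty s : factor_costs s !=set0.
Proof.
elim: (size s) {-2}s (leqnn (size s)) => [|n IH] {}s hs.
  exists 0, [::], s; split=> //; last by rewrite /total_cost big_nil.
  by apply: leq_ltn_trans hs k_gt0.
have [hk|hk] := ltnP (size s) k.
  by exists 0, [::], s; split=> //; rewrite /total_cost big_nil.
have [|_ [cs [rest [h1 h2 h3 _]]]] := IH (drop k s).
  by rewrite size_drop leq_subLR (leq_trans hs) // -add1n leq_add2r.
exists (total_cost (take k s :: cs)), (take k s :: cs), rest; split=> //=.
  by rewrite -catA -[s in perm_eq s](cat_take_drop k) perm_cat2l.
by rewrite h2 size_takel ?eqxx.
Qed.

Lemma min_cost_ge0 s : 0 <= min_cost s.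
Proof. by apply: lb_le_inf (factor_costs_nonempty s) (@factor_costs_lbound s). Qed.

Lemma min_cost_le s c : factor_costs s c -> min_cost s <= c.
Proof. by apply: ge_inf; exists 0; apply: factor_costs_lbound. Qed.

Lemma le_min_cost s b : (forall c, factor_costs s c -> b <= c) -> b <= min_cost s.
Proof. by move=> h; apply: lb_le_inf => //; apply: factor_costs_nonempty. Qed.

Lemma partial_factor_costs s c : factor_costs s c -> partial_factor s c k.
Proof. by case=> cs [rest [h1 h2 h3 ->]]; exists cs, rest; split=> //; apply: ltnW. Qed.

(** [min_cost] is defined as an infimum; the slack [e] replaces attainment, and its users let it
    tend to 0. *)
Lemma partial_factor_min_cost s e : 0 < e -> partial_factor s (min_cost s + e) k.
Proof.
move=> e0; have [|c /partial_factor_costs[cs [rest [h1 h2 h3 h4]]] hc] := @inf_adherent _ (factor_costs s) e e0.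
  by split; [exact: factor_costs_nonempty | exists 0; apply: factor_costs_lbound].
by exists cs, rest; split=> //; apply: le_trans h4 (ltW hc).
Qed.

Lemma partial_factor_le s c c' rho rho' : c <= c' -> (rho <= rho')%N -> partial_factor s c rho -> partial_factor s c' rho'.
Proof.
move=> cc rr [cs [rest [h1 h2 h3 h4]]]; exists cs, rest; split=> //.
  exact: leq_trans h3 rr.
exact: le_trans h4 cc.
Qed.

Lemma partial_factor_perm s s' c rho : perm_eq s s' -> partial_factor s c rho -> partial_factor s' c rho.
Proof.
move=> ss' [cs [rest [h1 h2 h3 h4]]]; exists cs, rest; split=> //.
by rewrite -(permPl ss').
Qed.

Lemma partial_factor_cat s s' c c' rho rho' : partial_factor s c rho -> partial_factor s' c' rho' ->
  partial_factor (s ++ s') (c + c') (rho + rho').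
Proof.
move=> [cs [rest [h1 h2 h3 h4]]] [cs' [rest' [h1' h2' h3' h4']]].
exists (cs ++ cs'), (rest ++ rest'); split.
- rewrite (perm_trans (perm_cat h1 h1')) // flatten_cat -!catA perm_cat2l.
  by rewrite perm_sym perm_catCA.
- by rewrite all_cat h2.
- by rewrite size_cat leq_add.
- by rewrite total_cost_cat lerD.
Qed.

Lemma partial_factor_all s : partial_factor s 0 (size s).
Proof. by exists [::], s; split=> //; rewrite /total_cost big_nil. Qed.

(** A deleted point meets at most one chunk. Dropping that chunk does not raise the cost and frees
    its remaining points, fewer than [k]. *)
Lemma partial_factor_rem x s c rho : partial_factor (x :: s) c rho -> partial_factor s c (rho + k).
Proof.
move=> [cs [rest [h1 h2 h3 h4]]].
have : x \in flatten cs ++ rest by rewrite -(perm_mem h1) inE eqxx.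
rewrite mem_cat; case/boolP: (x \in flatten cs) => [/flattenP[c0 hc0 xc0] _|_ /= xr].
  exists (rem c0 cs), (rem x c0 ++ rest); split.
  - have p1 := permP (perm_flatten (perm_to_rem hc0)).
    have p2 := permP (perm_to_rem xc0); apply/permP => a.
    by move: (permP h1 a) (p1 a) (p2 a); rewrite /= !count_cat /=; lia.
  - by apply/allP => c' /mem_rem; apply: (allP h2).
  - rewrite size_cat size_rem // (eqP (allP h2 _ hc0)).
    by rewrite addnC leq_add // leq_pred.
  - apply: le_trans h4; rewrite /total_cost (perm_big _ (perm_to_rem hc0)).
    by rewrite big_cons /= lerDr chunk_cost_ge0.
exists cs, (rem x rest); split=> //; last by rewrite size_rem // (leq_trans (leq_pred _)) // (leq_trans h3) // leq_addr.
have p2 := permP (perm_to_rem xr); apply/permP => a.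
by move: (permP h1 a) (p2 a); rewrite /= !count_cat /=; lia.
Qed.

Lemma partial_factor_rem_seq u s c rho : partial_factor (u ++ s) c rho -> partial_factor s c (rho + k * size u).
Proof.
elim: u rho => [|x u IH] rho /=; first by rewrite muln0 addn0.
by move=> /partial_factor_rem /IH; rewrite mulnS addnA.
Qed.
End FactorCost.

(** * Growth and smoothness *)

Section Growth.
Variables (R : realType) (d k : nat) (E : rel 'I_k).
Hypothesis k_gt0 : (0 < k)%N.
Local Notation pt := (d.+1.-tuple R).

Definition incube (x : pt) : bool := [forall j, 0 <= tnth x j <= 1].

(** The minimum with [M.-1] puts the coordinate 1 into the last cell. *)
Definition cell_index (M : nat) (x : pt) (j : 'I_d.+1) : nat :=
  minn (Num.truncn (M%:R * tnth x j)) M.-1.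

Lemma cell_index_lt M x j : (0 < M)%N -> (cell_index M x j < M)%N.
Proof. by move=> M0; rewrite /cell_index gtn_min prednK // leqnn orbT. Qed.

Lemma cell_index_bounds M x j : (0 < M)%N -> incube x ->
  (cell_index M x j)%:R / M%:R <= tnth x j <= ((cell_index M x j)%:R + 1) / M%:R.
Proof.
move=> M0 /forallP /(_ j) /andP[x0 x1].
have M0' : 0 < M%:R :> R by rewrite ltr0n.
have y0 : 0 <= M%:R * tnth x j by rewrite mulr_ge0.
rewrite ler_pdivrMr // ler_pdivlMr // mulrC.
have := truncnS_gt (M%:R * tnth x j).
have : (Num.truncn (M%:R * tnth x j))%:R <= M%:R * tnth x j by rewrite truncn_le.
rewrite /cell_index; set t := Num.truncn _; rewrite -natr1 => h1 h2.
have [h|h] := leqP t M.-1; first by rewrite h1 ltW.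
have hM : M.-1%:R <= t%:R :> R by rewrite ler_nat ltnW.
by rewrite (le_trans hM h1) /= natr1 prednK // -[leRHS]mulr1 ler_wpM2l.
Qed.

Definition strip (M : nat) (M0 : (0 < M)%N) (x : pt) : {ffun 'I_d -> 'I_M} :=
  [ffun j => Ordinal (cell_index_lt x (lift ord0 j) M0)].

(* The cube is cut into [M ^ d] rods parallel to the first axis; the weight
   [d + 2] exceeds the diameter plus the length of a rod, so that increasing
   values of [height] traverse the rods one after the other. *)
Definition height (M : nat) (M0 : (0 < M)%N) (x : pt) : R :=
  d.+2%:R * (enum_rank (strip M0 x))%:R + tnth x ord0.

Lemma height_ge0 M (M0 : (0 < M)%N) x : incube x -> 0 <= height M0 x.
Proof. by move=> /forallP /(_ ord0) /andP[x0 _]; rewrite addr_ge0 ?mulr_ge0. Qed.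

Lemma height_le M (M0 : (0 < M)%N) x : incube x ->
  height M0 x <= d.+2%:R * M%:R ^+ d.
Proof.
move=> /forallP /(_ ord0) /andP[_ x1].
have h : (enum_rank (strip M0 x)).+1%:R <= M%:R ^+ d :> R.
  rewrite -natrX ler_nat; apply: leq_trans (ltn_ord _) _.
  by rewrite card_ffun !card_ord.
have : d.+2%:R * (enum_rank (strip M0 x)).+1%:R <= d.+2%:R * M%:R ^+ d :> R.
  by rewrite ler_wpM2l.
rewrite -[(enum_rank _).+1%:R]natr1 mulrDr mulr1; apply: le_trans.
by rewrite lerD2l (le_trans x1) // ler1n.
Qed.

Lemma incube_dist_coord x y j : incube x -> incube y ->
  `|tnth x j - tnth y j| <= 1.
Proof.
move=> /forallP /(_ j) /andP[x0 x1] /forallP /(_ j) /andP[y0 y1].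
by rewrite ler_norml; apply/andP; split; lra.
Qed.

(** In a common rod, only the first coordinate contributes more than 1/M. In different rods, the
    heights differ by at least d+2 minus the rod length 1, and d+1 already bounds the distance of
    any two points of the cube. *)
Lemma dist_height M (M0 : (0 < M)%N) x y : incube x -> incube y ->
  height M0 x <= height M0 y ->
  eucl_dist x y <= height M0 y - height M0 x + d.+1%:R / M%:R.
Proof.
move=> cx cy hxy; have Mp : 0 < M%:R :> R by rewrite ltr0n.
have [e|ne] := eqVneq (strip M0 x) (strip M0 y).
  move: hxy; rewrite /height e lerD2l => hxy.
  apply: le_trans (eucl_dist_le_sum _ _) _; rewrite big_ord_recl.
  rewrite ler0_norm ?subr_le0 // opprD opprK.
  have : \sum_(i < d) `|tnth x (lift ord0 i) - tnth y (lift ord0 i)|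
      <= \sum_(i < d) 1 / M%:R.
    apply: ler_sum => i _.
    have := congr1 (fun f : {ffun 'I_d -> 'I_M} => nat_of_ord (f i)) e; rewrite !ffunE /= => ei.
    have /andP[h1 h2] := cell_index_bounds (lift ord0 i) M0 cx.
    have /andP[h3 h4] := cell_index_bounds (lift ord0 i) M0 cy.
    rewrite ei in h1 h2; move: h1 h2 h3 h4; rewrite mulrDl.
    by rewrite ler_norml => *; apply/andP; split; lra.
  rewrite sumr_const card_ord -[_ *+ d]mulr_natl mul1r => h.
  have hd : d%:R / M%:R <= d.+1%:R / M%:R :> R.
    by rewrite ler_wpM2r ?invr_ge0 ?ler_nat ?ltW.
  lra.
have rne : enum_rank (strip M0 x) != enum_rank (strip M0 y).
  by rewrite (inj_eq enum_rank_inj).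
have x0 : 0 <= tnth x ord0 <= 1 by move/forallP: cx; apply.
have y0 : 0 <= tnth y ord0 <= 1 by move/forallP: cy; apply.
have hd : eucl_dist x y <= d.+1%:R.
  apply: le_trans (eucl_dist_le_sum _ _) _.
  apply: (@le_trans _ _ (\sum_(j < d.+1) 1)).
    by apply: ler_sum => j _; apply: incube_dist_coord.
  by rewrite sumr_const card_ord.
(* First coordinates differ by at most 1, less than the weight d+2 of one rank, so the order of
   heights determines the order of ranks. *)
have lt_rank : (enum_rank (strip M0 x) < enum_rank (strip M0 y))%N.
  rewrite ltn_neqAle rne /= leqNgt; apply/negP => hlt.
  have : (enum_rank (strip M0 y))%:R + 1 <= (enum_rank (strip M0 x))%:R :> R.
    by rewrite natr1 ler_nat.
  move: hxy; rewrite /height.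
  have d2 : 2 <= d.+2%:R :> R by rewrite ler_nat.
  move: x0 y0 => /andP[? ?] /andP[? ?]; nra.
have hr : (enum_rank (strip M0 x))%:R + 1 <= (enum_rank (strip M0 y))%:R :> R.
  by rewrite natr1 ler_nat.
have d2 : d.+2%:R = d.+1%:R + 1 :> R by rewrite natr1.
have dp : 0 <= d.+1%:R / M%:R :> R by rewrite divr_ge0.
rewrite /height d2; move: x0 y0 => /andP[? ?] /andP[? ?].
have d1 : 0 <= d.+1%:R :> R by [].
nra.
Qed.

(** Consecutive points of the sorted list form the chunks. The diameter of a chunk is at most its
    range of [phi] plus [eta], and these ranges telescope inside the interval from [a] to [B]. *)
Lemma sorted_chunks (phi : pt -> R) (eta : R) m (s : seq pt) (a B : R) :
  0 <= eta ->
  {in s &, forall x y, phi x <= phi y -> eucl_dist x y <= phi y - phi x + eta} ->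
  pairwise (fun x y => phi x <= phi y) s ->
  {in s, forall x, a <= phi x <= B} -> a <= B -> (m * k <= size s)%N ->
  exists cs, [/\ flatten cs = take (m * k) s,
    all (fun c => size c == k) cs &
    total_cost E cs <= k%:R ^+ 2 * (B - a + m%:R * eta)].
Proof.
move=> eta0; elim: m s a => [|m IH] s a hs ps hab aB hm.
  exists [::]; rewrite mul0n take0; split=> //.
  by rewrite /total_cost big_nil mulr_ge0 ?sqr_ge0 // mul0r addr0 subr_ge0.
have hk : (k <= size s)%N by apply: leq_trans hm; rewrite mulSn leq_addr.
have sc : size (take k s) = k by rewrite size_takel.
set c := take k s in sc *; set t := drop k s.
have sE : s = c ++ t by rewrite cat_take_drop.
(* The last point [z] of the chunk has its largest value of [phi], which becomes the lower end [a]
   for the remaining chunks. *)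
have [c' [z cE]] : exists c' z, c = rcons c' z.
  case/lastP: (c) sc => [|c' z _]; last by exists c', z.
  by move=> /= k0; move: k_gt0; rewrite -k0.
have zs : z \in s by rewrite sE cE mem_cat mem_rcons inE eqxx.
have /andP[az zB] := hab _ zs.
move: ps; rewrite sE pairwise_cat => /and3P[/allrelP pct pc pt_].
have cz x : x \in c -> phi x <= phi z.
  move: pc; rewrite cE pairwise_rcons => /andP[/allP h _].
  by rewrite mem_rcons inE => /orP[/eqP->//|/h].
have [|||cs [h1 h2 h3]] := IH t (phi z) _ pt_ _ zB.
- by move=> x y xt yt; apply: hs; rewrite sE mem_cat ?xt ?yt orbT.
- move=> x xt; have xs : x \in s by rewrite sE mem_cat xt orbT.
  have /andP[_ ->] := hab _ xs; rewrite andbT pct //.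
  by rewrite cE mem_rcons inE eqxx.
- by rewrite size_drop leq_subRL // -mulSn.
exists (c :: cs); split=> /=.
- by rewrite h1 mulSn take_cat sc ltnNge leq_addr /= addKn.
- by rewrite sc eqxx.
rewrite /total_cost big_cons.
have hc : chunk_cost E c <= k%:R ^+ 2 * (phi z - a + eta).
  apply: chunk_cost_le => //; first by rewrite addr_ge0 // subr_ge0.
  move=> x y xc yc.
  have xs : x \in s by rewrite sE mem_cat xc.
  have ys : y \in s by rewrite sE mem_cat yc.
  have /andP[ax xB] := hab _ xs; have /andP[ay yB] := hab _ ys.
  have := cz _ xc; have := cz _ yc.
  have [xy|/ltW yx] := leP (phi x) (phi y).
    by have := hs _ _ xs ys xy; lra.
  by have := hs _ _ ys xs yx; rewrite eucl_distC; lra.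
apply: le_trans (lerD hc h3) _; rewrite -mulrDr ler_wpM2l ?sqr_ge0 //.
by rewrite -[m.+1%:R]natr1; lra.
Qed.

(** The first term is the total height of the rods, the second one rod width for each of [rho]
    points. The two balance when M is of order rho^(1/(d+1)). *)
Definition growth_bound (M rho : nat) : R :=
  k%:R ^+ 2 * (d.+2%:R * M%:R ^+ d + rho%:R * (d.+1%:R / M%:R)).

Lemma growth_bound_le M rho rho' : (rho <= rho')%N -> growth_bound M rho <= growth_bound M rho'.
Proof.
move=> h; rewrite /growth_bound ler_wpM2l ?sqr_ge0 // lerD2l ler_wpM2r ?divr_ge0 //.
by rewrite ler_nat.
Qed.

Lemma growth M (s : seq pt) : (0 < M)%N -> all incube s ->
  exists2 c, factor_costs E s c & c <= growth_bound M (size s).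
Proof.
move=> M0 /allP hs; pose r := relpre (height M0) (fun a b : R => a <= b).
have Mp : 0 < M%:R :> R by rewrite ltr0n.
pose t := sort r s; pose m := (size s %/ k)%N.
have ts : perm_eq t s by rewrite perm_sort.
have tc x : x \in t -> incube x by rewrite (perm_mem ts); apply: hs.
have st : size t = size s by apply: perm_size.
have e0 : 0 <= d.+1%:R / M%:R :> R by rewrite divr_ge0.
have [|||||cs [h1 h2 h3]] := @sorted_chunks (height M0) (d.+1%:R / M%:R) m t 0
    (d.+2%:R * M%:R ^+ d) e0.
- by move=> x y /tc cx /tc cy; apply: dist_height.
- rewrite -sorted_pairwise; last by move=> y x z; apply: le_trans.
  by apply: sort_sorted => x y; apply: le_total.
- by move=> x /tc cx; rewrite height_ge0 ?height_le.
- by rewrite mulr_ge0 ?exprn_ge0.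
- by rewrite st leq_divM.
exists (total_cost E cs).
  exists cs, (drop (m * k) t); split=> //.
    by rewrite h1 cat_take_drop perm_sym.
  by rewrite size_drop st /m {1}(divn_eq (size s) k) addKn ltn_mod.
apply: le_trans h3 _; rewrite /growth_bound ler_wpM2l ?sqr_ge0 // subr0 lerD2l.
by rewrite ler_wpM2r // ler_nat leq_div.
Qed.

(** The uncovered points receive a factor of their own, whose cost is given by [growth]. *)
Lemma min_cost_le_partial M (s : seq pt) c rho : (0 < M)%N -> all incube s ->
  partial_factor E s c rho -> min_cost E s <= c + growth_bound M rho.
Proof.
move=> M0 hs [cs [rest [h1 h2 h3 h4]]].
have [|c' [cs' [rest' [g1 g2 g3 g4]]] hc'] := @growth M rest M0.
  by apply/allP => x xr; apply: (allP hs); rewrite (perm_mem h1) mem_cat xr orbT.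
apply: (@le_trans _ _ (total_cost E cs + c')).
  apply: min_cost_le; exists (cs ++ cs'), rest'; split=> //.
  - by rewrite (perm_trans h1) // flatten_cat -catA perm_cat2l.
  - by rewrite all_cat h2.
  - by rewrite g4 total_cost_cat.
by rewrite lerD // (le_trans hc') // growth_bound_le.
Qed.

Definition smooth_const : R := k%:R ^+ 2 * d.+2%:R * k.+1%:R.

Lemma smooth_const_ge0 : 0 <= smooth_const.
Proof. by rewrite /smooth_const !mulr_ge0 ?sqr_ge0. Qed.

(** From a nearly optimal factor of [s'], delete [v'] and add [v] as uncovered points. At most k + k
    |v'| + |v| points are then uncovered, and they are covered again within the growth bound. *)
Lemma min_cost_smooth M (s s' u v v' : seq pt) : (0 < M)%N -> all incube s ->
  perm_eq s (u ++ v) -> perm_eq s' (u ++ v') ->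
  min_cost E s <= min_cost E s' + smooth_const * (M%:R ^+ d + (size v + size v')%:R / M%:R).
Proof.
move=> M0 hs huv huv'.
have Mp : 0 < M%:R :> R by rewrite ltr0n.
apply/ler_addgt0Pr => e e0.
have /(partial_factor_perm huv') : partial_factor E s' (min_cost E s' + e) k by exact: partial_factor_min_cost.
have p1 : perm_eq (u ++ v') (v' ++ u) by rewrite perm_catC.
move=> /(partial_factor_perm p1) /partial_factor_rem_seq => /(_ k_gt0) h1.
have h2 := partial_factor_perm _ (partial_factor_cat h1 (partial_factor_all E v)).
have {h2} /h2 h2 : perm_eq (u ++ v) s by rewrite perm_sym.
apply: le_trans (min_cost_le_partial M0 hs h2) _.
rewrite addr0 -addrA [e + _]addrC addrA lerD2r lerD2l.
rewrite /growth_bound /smooth_const -!mulrA ler_wpM2l ?sqr_ge0 // mulrDr mulrDr.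
set w := M%:R ^+ d; set i := M%:R^-1.
have w1 : 1 <= w by rewrite exprn_ege1 // ler1n.
have i0 : 0 <= i by rewrite invr_ge0 ltW.
have i1 : i <= 1 by rewrite invf_le1 // ler1n.
have d1 : 0 <= d.+1%:R :> R by [].
rewrite -[d.+2%:R]natr1 -[k.+1%:R]natr1 !natrD natrM.
set D := d.+1%:R in d1 *; set K := k%:R.
have K1 : 1 <= K by rewrite ler1n.
set a : R := (size v)%:R; set a' : R := (size v')%:R.
have a0 : 0 <= a by []. have a0' : 0 <= a' by [].
have -> : (K + K * a' + a) * (D * i) = D * K * i + D * (K * (a' * i)) + D * (a * i) by ring.
have ai : 0 <= a * i by rewrite mulr_ge0.
have ai' : 0 <= a' * i by rewrite mulr_ge0.
have -> : (a + a') * i = a * i + a' * i by ring.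
set p := a * i in ai *; set q := a' * i in ai' *.
have h3 : D * K * i <= D * K * w.
  by rewrite ler_wpM2l ?mulr_ge0 ?(le_trans ler01 K1) // (le_trans i1).
have K0 : 0 <= K by exact: le_trans ler01 K1.
have w0 : 0 <= w by exact: le_trans ler01 w1.
have h4 : 0 <= K * w by rewrite mulr_ge0.
have h5 : 0 <= D * (K * p) by rewrite !mulr_ge0.
have h6 : 0 <= D * q by rewrite !mulr_ge0.
have h7 : 0 <= (K + 1) * (p + q) by rewrite !mulr_ge0 ?addr_ge0.
rewrite -mulrDr ler_wpM2l //; lra.
Qed.

Lemma min_cost_smooth_abs M (s s' u v v' : seq pt) : (0 < M)%N ->
  all incube s -> all incube s' ->
  perm_eq s (u ++ v) -> perm_eq s' (u ++ v') ->
  `|min_cost E s - min_cost E s'| <= smooth_const * (M%:R ^+ d + (size v + size v')%:R / M%:R).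
Proof.
move=> M0 hs hs' h h'; rewrite ler_distl lerBlDr.
rewrite (min_cost_smooth M0 hs h h') andbT.
by rewrite [(size v + _)%N]addnC; apply: min_cost_smooth h' h.
Qed.
End Growth.

Arguments incube {R d} x.

(** * Rounding, scaling and subadditivity *)

Section Lifting.
Variables (R : realType) (d k : nat) (E : rel 'I_k).
Hypothesis k_gt0 : (0 < k)%N.
Local Notation pt := (d.-tuple R).

Lemma perm_map_lift (T U : eqType) (g : T -> U) (s : seq T) (t : seq U) :
  perm_eq (map g s) t -> exists2 t', perm_eq s t' & map g t' = t.
Proof.
case: s => [|x0 s] h.
  exists [::] => //; apply/esym/nilP.
  by rewrite /nilp -(perm_size h).
move: h; rewrite perm_sym => /(perm_iotaP (g x0)) [Is pIs tE].
exists (map (nth x0 (x0 :: s)) Is).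
  rewrite perm_sym; apply/(perm_iotaP x0); exists Is => //.
  by move: pIs; rewrite size_map.
rewrite tE -map_comp; apply/eq_in_map => i.
rewrite (perm_mem pIs) mem_iota size_map add0n /= => hi.
by rewrite (nth_map x0 (g x0) g (s := x0 :: s)).
Qed.

Lemma map_flatten_lift (T U : Type) (g : T -> U) (u : seq T) (cs : seq (seq U))
    (v : seq U) : map g u = flatten cs ++ v ->
  exists cs' v', [/\ u = flatten cs' ++ v', map (map g) cs' = cs & map g v' = v].
Proof.
elim: cs u => [|c cs IH] u /=; first by move=> h; exists [::], u.
rewrite -catA => h.
have h1 : map g (take (size c) u) = c by rewrite map_take h take_size_cat.
have /IH[cs' [v' [h2 h3 h4]]] : map g (drop (size c) u) = flatten cs ++ v.
  by rewrite map_drop h drop_size_cat.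
exists (take (size c) u :: cs'), v'; split=> //=; last by rewrite h1 h3.
by rewrite -catA -h2 cat_take_drop.
Qed.

(** Points are treated as images of labels. Lifting the chunks to the labels lets two embeddings of
    the same labels be compared chunk by chunk, even where an embedding identifies labels. *)
Lemma factor_costs_lift (T : eqType) (g : T -> pt) (s : seq T) c : factor_costs E (map g s) c ->
  exists cs rest, [/\ perm_eq s (flatten cs ++ rest),
    all (fun c => size c == k) cs, (size rest < k)%N &
    c = total_cost E (map (map g) cs)].
Proof.
move=> [cs [rest [/perm_map_lift[t st gt] h2 h3 ->]]].
have [cs' [rest' [h4 h5 h6]]] := map_flatten_lift gt.
exists cs', rest'; split.
- by rewrite -h4.
- by move: h2; rewrite -h5 all_map; congr is_true; apply: eq_all => c' /=; rewrite size_map.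
- by rewrite -h6 size_map in h3.
- by rewrite h5.
Qed.

Lemma factor_costs_map (T : eqType) (g : T -> pt) (s : seq T) cs rest :
  perm_eq s (flatten cs ++ rest) -> all (fun c => size c == k) cs ->
  (size rest < k)%N -> factor_costs E (map g s) (total_cost E (map (map g) cs)).
Proof.
move=> h1 h2 h3; exists (map (map g) cs), (map g rest); split=> //.
- by rewrite -map_flatten -map_cat perm_map.
- rewrite all_map; move: h2; congr is_true; apply: eq_all => c /=.
  by rewrite size_map.
- by rewrite size_map.
Qed.

(** The same chunks serve for both embeddings. There are at most [size s] of them, and each of at
    most k^2 edges changes by at most [2 * h]. *)
Lemma min_cost_round (T : eqType) (f g : T -> pt) (h : R) (s : seq T) : 0 <= h ->
  {in s, forall x, eucl_dist (f x) (g x) <= h} ->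
  min_cost E (map f s) <= min_cost E (map g s) + (size s)%:R * (k%:R ^+ 2 * (2 * h)).
Proof.
move=> h0 hfg; rewrite -lerBlDr; apply: le_min_cost => // c /factor_costs_lift.
move=> [cs [rest [h1 h2 h3 ->]]]; rewrite lerBlDr.
apply: le_trans (min_cost_le (factor_costs_map f h1 h2 h3)) _.
have hs : (size cs <= size s)%N.
  rewrite (perm_size h1) size_cat; apply: leq_trans (leq_addr _ _).
  elim: cs {h1} h2 => //= c' cs IH /andP[/eqP hc /IH].
  by rewrite size_cat hc; lia.
have hm : {in flatten cs, forall x, eucl_dist (f x) (g x) <= h}.
  by move=> x xc; apply: hfg; rewrite (perm_mem h1) mem_cat xc.
apply: (@le_trans _ _ (total_cost E (map (map g) cs) +
    (size cs)%:R * (k%:R ^+ 2 * (2 * h)))); last first.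
  rewrite lerD2l ler_wpM2r ?ler_nat //.
  by rewrite mulr_ge0 ?sqr_ge0 ?mulr_ge0.
elim: cs {h1 hs} h2 hm => [|c' cs IH] /=.
  by rewrite /total_cost !big_nil mul0r addr0.
move=> /andP[/eqP hc h2] hm; rewrite /total_cost !big_cons -natr1.
have h4 : chunk_cost E (map f c') <= chunk_cost E (map g c') + k%:R ^+ 2 * (2 * h).
  by apply: chunk_cost_map => // x xc; apply: hm; rewrite mem_cat xc.
have : {in flatten cs, forall x, eucl_dist (f x) (g x) <= h}.
  by move=> x xc; apply: hm; rewrite mem_cat xc orbT.
move=> /(IH h2).
rewrite /total_cost; set a := \sum_(_ <- _) _; set b := \sum_(_ <- _) _; lra.
Qed.

Lemma min_cost_scale (T : eqType) (f g : T -> pt) (r : R) (s : seq T) : 0 < r ->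
  (forall x y, eucl_dist (f x) (f y) = r * eucl_dist (g x) (g y)) ->
  min_cost E (map f s) <= r * min_cost E (map g s).
Proof.
move=> r0 hfg; rewrite mulrC -ler_pdivrMr //; apply: le_min_cost => // c /factor_costs_lift.
move=> [cs [rest [h1 h2 h3 ->]]]; rewrite ler_pdivrMr //.
apply: le_trans (min_cost_le (factor_costs_map f h1 h2 h3)) _.
rewrite /total_cost mulr_suml !big_map.
rewrite big_seq [leRHS]big_seq; apply: ler_sum => c' /(allP h2)/eqP hc.
by rewrite (chunk_cost_scale _ (ltW r0) hc hfg) mulrC lexx.
Qed.

(** The classes of [key] are factored separately; both costs and uncovered points add up. *)
Lemma partial_factor_partition (T : eqType) (A : finType) (key : T -> A) (F : T -> pt)
    (c : A -> R) rho (s : seq T) :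
  (forall Q, partial_factor E (map F [seq p <- s | key p == Q]) (c Q) rho) ->
  partial_factor E (map F s) (\sum_Q c Q) (#|A| * rho).
Proof.
move=> h.
suff main (r : seq A) : uniq r ->
    partial_factor E (map F [seq p <- s | key p \in r]) (\sum_(Q <- r) c Q) (size r * rho).
  have := main (enum A) (enum_uniq A); rewrite -cardE big_enum /=.
  have -> : [seq p <- s | key p \in enum A] = s.
    by apply/all_filterP/allP => p _; rewrite mem_enum.
  by [].
elim: r => [_|Q r IH /= /andP[Qr /IH hr]].
  rewrite big_nil mul0n (eq_filter (a2 := pred0)) // filter_pred0.
  exact: (partial_factor_all E [::]).
rewrite big_cons mulSn.
apply: partial_factor_perm (partial_factor_cat (h Q) hr).
rewrite -map_cat perm_map //; apply/permP => a; rewrite count_cat !count_filter.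
elim: s {h IH hr} => //= p s IH; rewrite inE.
case: eqP => [kp|_] /=; last by lia.
by rewrite kp (negbTE Qr) andbT andbF; lia.
Qed.
End Lifting.

(** * Grid points and their splitting into a coarse and a fine position *)

Section Grid.
Variables (R : realType) (d : nat).
Local Notation pt := (d.+1.-tuple R).
Local Notation grid N := {ffun 'I_d.+1 -> 'I_N}.

Definition grid_point (N : nat) (g : grid N) : pt := [tuple (g j)%:R / N%:R | j < d.+1].

Lemma card_grid N : #|grid N| = (N ^ d.+1)%N.
Proof. by rewrite card_ffun !card_ord. Qed.

Lemma card_grid_gt0 N : (0 < N)%N -> (0 < #|grid N|)%N.
Proof. by move=> N0; rewrite card_grid expn_gt0 N0. Qed.

Lemma grid_point_incube N (g : grid N) : incube (grid_point g).
Proof.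
apply/forallP => j; rewrite tnth_mktuple.
have N0 : 0 < N%:R :> R by rewrite ltr0n (leq_ltn_trans _ (ltn_ord (g j))).
by apply/andP; split; [rewrite divr_ge0|rewrite ler_pdivrMr // mul1r ler_nat ltnW].
Qed.

Lemma all_grid_point_incube N (s : seq (grid N)) : all incube (map (@grid_point N) s).
Proof. by rewrite all_map; apply/allP => g _; apply: grid_point_incube. Qed.

Definition cell_of N (N0 : (0 < N)%N) (x : pt) : grid N :=
  [ffun j => Ordinal (cell_index_lt x j N0)].

Lemma dist_close (h : R) (x y : pt) :
  (forall j, `|tnth x j - tnth y j| <= h) -> eucl_dist x y <= d.+1%:R * h.
Proof.
move=> xy; apply: le_trans (eucl_dist_le_sum _ _) _.
apply: (@le_trans _ _ (\sum_(j < d.+1) h)); first exact: ler_sum.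
by rewrite sumr_const card_ord -[h *+ _]mulr_natl.
Qed.

Lemma dist_cell_of N (N0 : (0 < N)%N) x : incube x ->
  eucl_dist x (grid_point (cell_of N0 x)) <= d.+1%:R / N%:R.
Proof.
move=> cx; apply: dist_close => j; rewrite tnth_mktuple ffunE /=.
have := cell_index_bounds j N0 cx; rewrite mulrDl mul1r => /andP[h1 h2].
by rewrite ler_norml; apply/andP; split; lra.
Qed.

Lemma join_lt m N (q : 'I_m) (c : 'I_N) : (q * N + c < m * N)%N.
Proof.
apply: (@leq_trans (q.+1 * N)); last by rewrite leq_mul2r ltn_ord orbT.
by rewrite mulSn addnC ltn_add2r.
Qed.

(** Writing each coordinate in two digits, coarse then fine, is a bijection. Hence a uniform point
    of the fine grid is a uniform subcube together with an independent uniform point inside it. *)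
Definition join m N (p : grid m * grid N) : grid (m * N) :=
  [ffun j => Ordinal (join_lt (p.1 j) (p.2 j))].

Lemma join_bij m N : bijective (@join m N).
Proof.
apply: inj_card_bij; last by rewrite card_prod !card_grid expnMn.
move=> [q c] [q' c'] /ffunP h.
have qc j : q j = q' j /\ c j = c' j.
  have := congr1 (@nat_of_ord _) (h j); rewrite !ffunE /= => e.
  have N0 : (0 < N)%N by apply: leq_ltn_trans (ltn_ord (c j)).
  split; apply: val_inj => /=.
    have := congr1 (divn^~ N) e; rewrite !divnMDl // !divn_small ?ltn_ord //.
    by rewrite !addn0.
  by have := congr1 (modn^~ N) e; rewrite !modnMDl !modn_small ?ltn_ord.
by congr (_, _); apply/ffunP => j; case: (qc j).
Qed.

Lemma grid_point_join m N (p : grid m * grid N) j : (0 < N)%N ->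
  tnth (grid_point (join p)) j = ((p.1 j)%:R + tnth (grid_point p.2) j) / m%:R.
Proof.
move=> N0; rewrite !tnth_mktuple ffunE /= natrD !natrM; field.
by rewrite !pnatr_eq0 -!lt0n N0 (leq_ltn_trans _ (ltn_ord (p.1 j))).
Qed.
End Grid.

(** * Mean cost of a uniform sample of grid points *)

Section Mean.
Variables (R : realType) (d k : nat) (E : rel 'I_k).
Hypothesis k_gt0 : (0 < k)%N.
Local Notation grid N := {ffun 'I_d.+1 -> 'I_N}.

Definition grid_cost N (s : seq (grid N)) : R := min_cost E (map (@grid_point R d N) s).
Definition grid_mean n N : R := expect n (@grid_cost N).

Lemma grid_mean_ge0 n N : (0 < N)%N -> 0 <= grid_mean n N.
Proof.
move=> N0; rewrite -(expect_cst (card_grid_gt0 d N0) n 0).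
by apply: expect_le => s _; apply: min_cost_ge0.
Qed.

Lemma grid_mean_le n N M : (0 < N)%N -> (0 < M)%N -> grid_mean n N <= growth_bound R d k M n.
Proof.
move=> N0 M0; rewrite -(expect_cst (card_grid_gt0 d N0) n (growth_bound R d k M n)).
apply: expect_le => s hs.
have [c hc cg] := growth E k_gt0 M0 (all_grid_point_incube R s).
by rewrite size_map hs in cg; apply: le_trans cg; apply: min_cost_le.
Qed.

(** Coupling: the larger sample consists of the smaller one and [n - n'] further points. *)
Lemma grid_mean_smooth n n' N M : (0 < N)%N -> (0 < M)%N ->
  `|grid_mean n N - grid_mean n' N| <= smooth_const R d k * (M%:R ^+ d + `|n%:R - n'%:R| / M%:R).
Proof.
move=> N0 M0; wlog le_n : n n' / (n' <= n)%N.
  move=> h; have [/h//|/ltnW/h] := leqP n' n.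
  by rewrite (distrC (grid_mean n' N)) (distrC n'%:R).
set h := (n - n')%N.
have -> : `|n%:R - n'%:R| = h%:R :> R by rewrite -natrB // ger0_norm.
have -> : grid_mean n N = expect h (fun v => expect n' (fun u => @grid_cost N (v ++ u))).
  by rewrite -expect_cat subnK.
rewrite -(expect_cst (card_grid_gt0 d N0) h (grid_mean n' N)).
apply: (expect_dist (card_grid_gt0 d N0)) => v hv.
rewrite /grid_mean; apply: (expect_dist (card_grid_gt0 d N0)) => u hu.
rewrite /grid_cost -[h]addn0 -hv -(size_map (@grid_point R d N) v).
apply: (@min_cost_smooth_abs _ _ _ _ k_gt0 M _ _ (map (@grid_point R d N) u) _ [::]) => //;
  rewrite ?all_grid_point_incube ?cats0 //.
by rewrite map_cat perm_catC.
Qed.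

Lemma grid_mean_refine n m N : (0 < m)%N -> (0 < N)%N ->
  `|grid_mean n (m * N) - grid_mean n m| <=
    n%:R * (k%:R ^+ 2 * (2 * (d.+1%:R / m%:R))).
Proof.
move=> m0 N0; rewrite /grid_mean (expect_bij n _ (join_bij d m N)).
rewrite -(expect_fst n (@grid_cost m) (card_grid_gt0 d N0)).
have mp : 0 < m%:R :> R by rewrite ltr0n.
have hG : (0 < #|[the finType of (grid m * grid N)%type]|)%N.
  by rewrite card_prod muln_gt0 !card_grid_gt0.
apply: (expect_dist hG) => s hs; rewrite /grid_cost -!map_comp -hs.
have h0 : 0 <= d.+1%:R / m%:R :> R by rewrite divr_ge0.
have hd (p : grid m * grid N) :
    eucl_dist (grid_point R (join p)) (grid_point R p.1) <= d.+1%:R / m%:R.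
  apply: dist_close => j; rewrite grid_point_join // [tnth (grid_point R p.1) j]tnth_mktuple.
  have im : 0 <= m%:R^-1 :> R by rewrite invr_ge0.
  rewrite mulrDl addrAC subrr add0r normrM (ger0_norm im).
  rewrite -[leRHS]mul1r ler_wpM2r //.
  have /forallP/(_ j)/andP[a b] := grid_point_incube R p.2.
  by rewrite ger0_norm.
rewrite ler_distl lerBlDr; apply/andP; split; apply: min_cost_round => // p _ /=;
  last exact: hd.
by rewrite eucl_distC; exact: hd.
Qed.

(** The value of [growth_bound] for [m] rods per axis and k uncovered points in each of the m^(d+1)
    subcubes, divided by m^d. *)
Definition subadd_const : R := k%:R ^+ 2 * (d.+2%:R + k%:R * d.+1%:R).

(** Each subcube is a copy of the cube scaled by 1/m and is factored on its own. By [expect_fiber]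
    the points in it form a uniform sample of random size; the at most k points left over in each
    subcube are covered together. *)
Lemma grid_mean_subadd_counts n m N : (0 < m)%N -> (0 < N)%N ->
  grid_mean n (m * N) <=
    (\sum_(Q : grid m) expect n (fun q => grid_mean (count_mem Q q) N)) / m%:R
    + subadd_const * m%:R ^+ d.
Proof.
move=> m0 N0; rewrite /grid_mean (expect_bij n _ (join_bij d m N)).
have mp : 0 < m%:R :> R by rewrite ltr0n.
have hG : (0 < #|[the finType of (grid m * grid N)%type]|)%N.
  by rewrite card_prod muln_gt0 !card_grid_gt0.
under eq_bigr => Q _ do rewrite -(expect_fiber n Q (@grid_cost N) (card_grid_gt0 d N0)).
rewrite -(expect_sum hG) mulrC -expectZ -[subadd_const * _](expect_cst hG n) -expectD.
apply: expect_le => s _; rewrite /grid_cost -map_comp /=.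
apply/ler_addgt0Pr => e e0.
(* The slack [e] is shared equally among the subcubes. *)
pose e' := e / #|grid m|%:R.
have g0 : 0 < #|grid m|%:R :> R by rewrite ltr0n card_grid_gt0.
have e'0 : 0 < e' by rewrite divr_gt0.
pose F := @grid_point R d (m * N) \o @join d m N.
have hP Q : partial_factor E (map F [seq p <- s | p.1 == Q])
   (m%:R^-1 * min_cost E (map (@grid_point R d N) [seq p.2 | p <- s & p.1 == Q]) + e') k.
  apply: partial_factor_le (partial_factor_min_cost E k_gt0 _ e'0) => //.
  rewrite lerD2r -map_comp.
  have -> : map F [seq p <- s | p.1 == Q] =
     map (fun p => F (Q, p.2)) [seq p <- s | p.1 == Q].
    by apply/eq_in_map => -[a b]; rewrite mem_filter /= => /andP[/eqP->].
  apply: min_cost_scale => //; first by rewrite invr_gt0.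
  move=> [a b] [a' b']; apply: eucl_dist_scale; first by rewrite invr_ge0 ltW.
  by move=> j; rewrite /F /= !grid_point_join //=; ring.
have hc : all incube (map F s).
  by rewrite all_map; apply/allP => p _; apply: grid_point_incube.
have := min_cost_le_partial k_gt0 m0 hc (partial_factor_partition k_gt0 hP).
move/le_trans; apply; rewrite big_split /= -mulr_sumr sumr_const.
have -> : e' *+ #|{: grid m}| = e by rewrite -[LHS]mulr_natr divfK ?gt_eqF.
have -> : growth_bound R d k m (#|grid m| * k) = subadd_const * m%:R ^+ d.
  by rewrite /growth_bound /subadd_const card_grid natrM natrX (exprS m%:R d); set w := m%:R ^+ d;
    field; rewrite gt_eqF.
by rewrite addrAC.
Qed.

(** A subcube receives w^2 points on average, with variance at most w^2. The inequality |x| <=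
    x^2/(2w) + w/2 bounds the mean deviation by [w] without a square root of an expectation. *)
Lemma expect_count_dist m w (Q : grid m) : (0 < m)%N -> (0 < w)%N ->
  expect (m ^ d.+1 * w ^ 2) (fun q => `|(count_mem Q q)%:R - (w ^ 2)%:R| : R)
  <= w%:R.
Proof.
move=> m0 w0; have wp : 0 < w%:R :> R by rewrite ltr0n.
have hG := card_grid_gt0 d m0.
set n := (m ^ d.+1 * w ^ 2)%N; set t : R := (w ^ 2)%:R.
apply: (@le_trans _ _ (expect n (fun q =>
    (2 * w%:R)^-1 * ((count_mem Q q)%:R + - t) ^+ 2 + w%:R / 2))).
  apply: expect_le => q _; set x := _ - t.
  have : 0 <= (`|x| - w%:R) ^+ 2 by exact: sqr_ge0.
  rewrite sqrrB real_normK ?num_real // => h.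
  have -> : (2 * w%:R)^-1 * x ^+ 2 + w%:R / 2 = (2 * w%:R)^-1 * (x ^+ 2 + w%:R ^+ 2).
    by field; rewrite gt_eqF.
  rewrite ler_pdivlMl ?mulr_gt0 //; lra.
rewrite expectD expectZ expect_cst // expect_count_mem //.
have np : n%:R * #|grid m|%:R^-1 = t.
  rewrite card_grid /n natrM mulrAC mulfV ?mul1r // natrX expf_neq0 //.
  by rewrite pnatr_eq0 -lt0n.
rewrite np subrr expr0n /= addr0.
have p0 : 0 <= #|grid m|%:R^-1 :> R by rewrite invr_ge0.
have tE : t = w%:R ^+ 2 by rewrite /t natrX.
have h : t * (1 - #|grid m|%:R^-1) <= w%:R ^+ 2.
  by rewrite -tE -[leRHS]mulr1 ler_wpM2l ?tE ?sqr_ge0 // lerBlDr lerDl.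
have : (2 * w%:R)^-1 * (t * (1 - #|grid m|%:R^-1)) <= (2 * w%:R)^-1 * w%:R ^+ 2.
  by rewrite ler_wpM2l // invr_ge0 mulr_ge0.
have -> : (2 * w%:R)^-1 * w%:R ^+ 2 = w%:R / 2 :> R by field; rewrite gt_eqF.
lra.
Qed.

(** Smoothness replaces the random number of points in a subcube by its mean w^2. The factor m^d
    comes from m^(d+1) subcubes, each scaled by 1/m. *)
Lemma grid_mean_subadd m w N M : (0 < m)%N -> (0 < w)%N -> (0 < N)%N -> (0 < M)%N ->
  grid_mean (m ^ d.+1 * w ^ 2) (m * N) <=
  m%:R ^+ d * (grid_mean (w ^ 2) N + smooth_const R d k * (M%:R ^+ d + w%:R / M%:R) + subadd_const).
Proof.
move=> m0 w0 N0 M0; have mp : 0 < m%:R :> R by rewrite ltr0n.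
have Mp : 0 < M%:R :> R by rewrite ltr0n.
have hG := card_grid_gt0 d m0.
apply: le_trans (grid_mean_subadd_counts _ m0 N0) _.
rewrite [leRHS]mulrDr [_ * subadd_const]mulrC lerD2r ler_pdivrMr // [leRHS]mulrAC -exprSr.
set c := grid_mean (w ^ 2) N + _.
apply: (@le_trans _ _ (\sum_(Q : grid m) c)); last first.
  by rewrite sumr_const card_grid -[leLHS]mulr_natl natrX.
apply: ler_sum => Q _; rewrite /c.
set n := (_ * _)%N.
apply: (@le_trans _ _ (expect n (fun q => (grid_mean (w ^ 2) N + smooth_const R d k * M%:R ^+ d) +
   (smooth_const R d k / M%:R) * `|(count_mem Q q)%:R - (w ^ 2)%:R|))).
  apply: expect_le => q _.
  have := grid_mean_smooth (count_mem Q q) (w ^ 2) N0 M0.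
  by rewrite ler_distl => /andP[_]; lra.
rewrite expectD expect_cst // expectZ -addrA lerD2l mulrDr lerD2l mulrAC mulrA ler_wpM2r ?invr_ge0 //.
by rewrite ler_wpM2l ?smooth_const_ge0 // expect_count_dist.
Qed.
End Mean.

(** * Convergence of the normalized means *)

Section Convergence.
Variable R : realType.

Definition tends (u : nat -> R) (l : R) :=
  forall e : R, 0 < e -> exists J, forall j, (J <= j)%N -> `|u j - l| <= e.

(** The limit is the infimum of [u T + C / T]. Above, a good [T] controls its multiples, and any
    large [j] is reached from a multiple in fewer than [T] steps of small increment. *)
Lemma near_subadditive_tends (u : nat -> R) (C : R) : 0 <= C ->
  (forall j, 0 <= u j) ->
  (forall i T, (0 < i)%N -> (0 < T)%N -> u (i * T)%N <= u T + C / T%:R) ->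
  (forall e : R, 0 < e -> exists J, forall j, (J <= j)%N -> `|u j.+1 - u j| <= e) ->
  exists l, tends u l.
Proof.
move=> C0 u0 usub udiff.
pose S := [set x : R | exists2 T, (0 < T)%N & x = u T + C / T%:R].
have S0 : S !=set0 by exists (u 1%N + C / 1%:R), 1%N.
have Slb : has_lbound S.
  by exists 0 => _ [T T0 ->]; rewrite addr_ge0 ?divr_ge0.
exists (inf S) => e e0.
have e2 : 0 < e / 2 by rewrite divr_gt0.
have [_ [T T0 ->] hT] := inf_adherent e2 (conj S0 Slb).
have Tp : 0 < T%:R :> R by rewrite ltr0n.
(* Fewer than [T] increments of this size add up to at most [e / 2]. *)
have [J hJ] := udiff (e / 2 / T%:R) (divr_gt0 e2 Tp).
have step j h : (J <= j)%N -> u (j + h)%N <= u j + h%:R * (e / 2 / T%:R).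
  move=> Jj; elim: h => [|h IH]; first by rewrite addn0 mul0r addr0.
  have := hJ (j + h)%N (leq_trans Jj (leq_addr _ _)).
  by rewrite ler_distl addnS -[h.+1%:R]natr1 => /andP[_]; lra.
exists (J + 2 * T + (Num.truncn (C / e)).+1)%N => j hj.
have jp : (0 < j)%N by lia.
have jp' : 0 < j%:R :> R by rewrite ltr0n.
rewrite ler_distl; apply/andP; split.
  have hS : S (u j + C / j%:R) by exists j.
  have := ge_inf Slb hS.
  have : C / j%:R <= e.
    rewrite ler_pdivrMr // mulrC -ler_pdivrMr //.
    apply: (le_trans (ltW (truncnS_gt _))); rewrite ler_nat.
    by apply: leq_trans hj; rewrite leq_addl.
  lra.
pose i := (j %/ T)%N.
have jE : j = (i * T + j %% T)%N by exact: divn_eq.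
have hm : (j %% T < T)%N by rewrite ltn_mod.
have i0 : (0 < i)%N by rewrite divn_gt0 //; lia.
have hJi : (J <= i * T)%N by lia.
have := step _ (j %% T)%N hJi; rewrite -jE.
have : (j %% T)%:R * (e / 2 / T%:R) <= e / 2.
  rewrite mulrA ler_pdivrMr // mulrC ler_wpM2l ?(ltW e2) //.
  by rewrite ler_nat ltnW.
have := usub _ _ i0 T0.
lra.
Qed.

Lemma exprn_gap p (x : R) : 1 <= x -> (x + 1) ^+ p <= x ^+ p + 2 ^+ p * x ^+ p / x.
Proof.
move=> x1; have x0 : 0 < x by exact: lt_le_trans x1.
(* The constant 2^p - 1 makes the induction close: it satisfies c' = 2 c + 1. *)
suff : (x + 1) ^+ p <= x ^+ p + (2 ^+ p - 1) * x ^+ p / x.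
  move/le_trans; apply; rewrite lerD2l ler_wpM2r ?invr_ge0 ?ler_wpM2r ?exprn_ge0 ?(ltW x0) //.
  by rewrite gerBl.
elim: p => [|p IH]; first by rewrite !expr0 subrr !mul0r addr0.
rewrite !exprS; apply: (@le_trans _ _ ((x + 1) * (x ^+ p + (2 ^+ p - 1) * x ^+ p / x))).
  by rewrite ler_wpM2l // addr_ge0 // ltW.
set y := x ^+ p; set c : R := 2 ^+ p - 1.
have y0 : 0 <= y by rewrite exprn_ge0 // ltW.
have c0 : 0 <= c by rewrite subr_ge0 exprn_ege1 // ler1n.
have -> : (x + 1) * (y + c * y / x) = x * y + y + c * y + c * y / x.
  by field; rewrite gt_eqF.
have -> : (2 * 2 ^+ p - 1) * (x * y) / x = y + c * y + c * y.
  by rewrite /c; field; rewrite gt_eqF.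
have : c * y / x <= c * y.
  by rewrite ler_pdivrMr // -[leLHS]mulr1 ler_wpM2l // mulr_ge0.
lra.
Qed.

Lemma gap_bound d (C : R) (A j : nat) : 0 <= C -> (0 < d)%N -> (0 < A)%N -> (0 < j)%N ->
  C * ((A * j)%:R ^+ d +
       ((j.+1 ^ (2 * d.+1))%:R - (j ^ (2 * d.+1))%:R) / (A * j)%:R) <=
  j%:R ^+ (2 * d) * (C * A%:R ^+ d / j%:R + C * 2 ^+ (2 * d.+1) / A%:R).
Proof.
move=> C0 d0 A0 j0.
have Ap : 0 < A%:R :> R by rewrite ltr0n.
have j1 : 1 <= j%:R :> R by rewrite ler1n.
have jp : 0 < j%:R :> R by rewrite ltr0n.
have h1 : (A * j)%:R ^+ d <= j%:R ^+ (2 * d) * (A%:R ^+ d / j%:R) :> R.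
  rewrite natrM exprMn [leRHS]mulrCA ler_wpM2l ?exprn_ge0 //.
  by rewrite ler_pdivlMr // -exprSr; apply: ler_weXn2l => //; lia.
have h2 : ((j.+1 ^ (2 * d.+1))%:R - (j ^ (2 * d.+1))%:R) / (A * j)%:R <=
    j%:R ^+ (2 * d) * (2 ^+ (2 * d.+1) / A%:R) :> R.
  rewrite natrM invfM [A%:R^-1 * _]mulrC !mulrA ler_wpM2r ?invr_ge0 //.
  rewrite ler_pdivrMr // !natrX -[j.+1%:R]natr1 lerBlDl.
  apply: le_trans (exprn_gap _ j1) _.
  have e3 : j%:R ^+ (2 * d.+1) = j%:R * (j%:R * j%:R ^+ (2 * d)) :> R.
    by rewrite -!exprS; congr (_ ^+ _); lia.
  rewrite lerD2l e3; set y := j%:R ^+ (2 * d).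
  by rewrite le_eqVlt; apply/orP; left; apply/eqP; field; rewrite gt_eqF.
apply: le_trans (ler_wpM2l C0 (lerD h1 h2)) _.
by rewrite le_eqVlt; apply/orP; left; apply/eqP; ring.
Qed.

(** The smoothness error between consecutive sample sizes, with M = A j. The increment of the sample
    size is of order j^(2d+1), so the second term is j^(2d) times O(1/A): [A] is fixed first. The
    first term is then smaller than j^(2d) by a factor of order 1/j, as [0 < d]. *)
Lemma gap_small d (C e : R) : 0 <= C -> (0 < d)%N -> 0 < e ->
  exists2 A, (0 < A)%N & exists2 J, (0 < J)%N & forall j, (J <= j)%N ->
  C * ((A * j)%:R ^+ d +
       ((j.+1 ^ (2 * d.+1))%:R - (j ^ (2 * d.+1))%:R) / (A * j)%:R) <=
  j%:R ^+ (2 * d) * e.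
Proof.
move=> C0 d0 e0; have e2 : 0 < e / 2 by rewrite divr_gt0.
have small (c : R) n : (Num.truncn (c / (e / 2)) < n)%N -> c / n%:R <= e / 2.
  move=> hn; have np : 0 < n%:R :> R by rewrite ltr0n; lia.
  rewrite ler_pdivrMr // mulrC -ler_pdivrMr //.
  by apply: (le_trans (ltW (truncnS_gt _))); rewrite ler_nat.
pose A := (Num.truncn (C * 2 ^+ (2 * d.+1) / (e / 2))).+1.
exists A => //; exists (Num.truncn (C * A%:R ^+ d / (e / 2))).+1 => // j hj.
apply: le_trans (gap_bound C0 d0 _ _) _ => //; first exact: leq_trans hj.
rewrite ler_wpM2l ?exprn_ge0 //.
have := small (C * A%:R ^+ d) j hj.
have := small (C * 2 ^+ (2 * d.+1)) A (ltnSn _).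
lra.
Qed.

Lemma tends_harmonic (C : R) : tends (fun j => C / j%:R) 0.
Proof.
move=> e e0; exists (Num.truncn (`|C| / e)).+1 => j hj.
have jp : 0 < j%:R :> R by rewrite ltr0n; lia.
have ij : 0 <= j%:R^-1 :> R by rewrite invr_ge0.
rewrite subr0 normrM (ger0_norm ij).
rewrite ler_pdivrMr // mulrC -ler_pdivrMr //.
by apply: (le_trans (ltW (truncnS_gt _))); rewrite ler_nat.
Qed.
End Convergence.

(** * Normalized means along the subsequence of sample sizes *)

Section Gamma.
Variables (R : realType) (d k : nat) (E : rel 'I_k).

(* Along the sample sizes [j ^ (2 (d + 1))] the normalization
   [n ^ (d / (d + 1))] is the integer [j ^ (2 d)]. *)
Definition sample_size j := (j ^ (2 * d.+1))%N.
(** With exponent 6 the rounding error, of order n/N = j^(2d-4), is negligible against j^(2d), and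
    the birthday bound n^2/N^(d+1) = j^(-2(d+1)) is summable. *)
Definition resolution j := (j ^ 6)%N.
Definition sample_mean j : R := grid_mean R d E (sample_size j) (resolution j).
Definition scaled_mean j : R := sample_mean j / j%:R ^+ (2 * d).

Lemma resolution_gt0 j : (0 < j)%N -> (0 < resolution j)%N.
Proof. by move=> j0; rewrite expn_gt0 j0. Qed.

Lemma sample_size_resolution j : (0 < j)%N ->
  (sample_size j)%:R / (resolution j)%:R <= j%:R ^+ (2 * d) / j%:R :> R.
Proof.
move=> j0; have jp : 0 < j%:R :> R by rewrite ltr0n.
have j1 : 1 <= j%:R :> R by rewrite ler1n.
rewrite ler_pdivlMr // mulrAC ler_pdivrMr ?ltr0n ?resolution_gt0 //.
rewrite -!natrX -!natrM ler_nat /sample_size /resolution -expnSr -expnD leq_pexp2l //; lia.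
Qed.

Hypotheses (k_gt0 : (0 < k)%N) (d_gt0 : (0 < d)%N).

Let Cr : R := k%:R ^+ 2 * (2 * d.+1%:R).

Let Cr_ge0 : 0 <= Cr.
Proof. by rewrite /Cr mulr_ge0 ?sqr_ge0. Qed.

Lemma scaled_mean_ge0 j : 0 <= scaled_mean j.
Proof.
rewrite divr_ge0 ?exprn_ge0 //; have [->|j0] := posnP j.
  by rewrite /sample_mean /sample_size exp0n //; apply: min_cost_ge0.
by rewrite /sample_mean grid_mean_ge0 ?resolution_gt0.
Qed.

Definition mean_const : R := k%:R ^+ 2 * (d.+2%:R + d.+1%:R).

Lemma mean_const_ge0 : 0 <= mean_const.
Proof. by apply: mulr_ge0; [exact: sqr_ge0 | exact: addr_ge0]. Qed.

Lemma sample_mean_le j : (0 < j)%N -> sample_mean j <= mean_const * j%:R ^+ (2 * d).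
Proof.
move=> j0; have jp : 0 < j%:R :> R by rewrite ltr0n.
(* M = j^2 gives both terms of the growth bound the order j^(2d). *)
have j2 : (0 < j ^ 2)%N by rewrite expn_gt0 j0.
apply: le_trans (grid_mean_le _ _ _ k_gt0 (sample_size j) (resolution_gt0 j0) j2) _.
rewrite /growth_bound /mean_const /sample_size -!mulrA ler_wpM2l ?sqr_ge0 // !natrX -exprM.
have -> : (2 * d.+1)%N = (2 * d + 2)%N by lia.
rewrite exprD; set y := j%:R ^+ (2 * d).
by rewrite le_eqVlt; apply/orP; left; apply/eqP; field; rewrite gt_eqF.
Qed.

Let C2 : R := 2 * smooth_const R d k + subadd_const R d k + Cr.

(** Subadditivity with i^2 subcubes per axis, w = T^(d+1) and M = T: the sample sizes match exactly,
    and the error T^d is at most T^(2d)/T. The grid i^2 T^6 is then refined by i^4 to reach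
    [resolution (i * T)]. *)
Lemma scaled_mean_mul i T : (0 < i)%N -> (0 < T)%N -> scaled_mean (i * T)%N <= scaled_mean T + C2 / T%:R.
Proof.
move=> i0 T0.
have ip : 0 < i%:R :> R by rewrite ltr0n.
have Tp : 0 < T%:R :> R by rewrite ltr0n.
have T1 : 1 <= T%:R :> R by rewrite ler1n.
have m0 : (0 < i ^ 2)%N by rewrite expn_gt0 i0.
have w0 : (0 < T ^ d.+1)%N by rewrite expn_gt0 T0.
have i4 : (0 < i ^ 4)%N by rewrite expn_gt0 i0.
have mN0 : (0 < i ^ 2 * resolution T)%N by rewrite muln_gt0 m0 resolution_gt0.
have h1 := grid_mean_subadd R d E k_gt0 m0 w0 (resolution_gt0 T0) T0.
have h2 := grid_mean_refine R d E k_gt0 (sample_size (i * T)) mN0 i4.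
have e1 : (i ^ 2 * resolution T * i ^ 4)%N = resolution (i * T) by rewrite /resolution expnMn; lia.
have e2 : ((i ^ 2) ^ d.+1 * (T ^ d.+1) ^ 2)%N = sample_size (i * T).
  by rewrite /sample_size expnMn -!expnM [(d.+1 * 2)%N]mulnC.
have e3 : ((T ^ d.+1) ^ 2)%N = sample_size T by rewrite /sample_size -expnM mulnC.
rewrite e2 e3 in h1; rewrite e1 in h2.
rewrite /scaled_mean ler_pdivrMr ?exprn_gt0 ?ltr0n ?muln_gt0 ?i0 //.
set a : R := T%:R ^+ (2 * d).
have ap : 0 < a by rewrite exprn_gt0.
set y : R := i%:R ^+ (2 * d).
have yp : 0 < y by rewrite exprn_gt0.
have -> : (i * T)%:R ^+ (2 * d) = y * a by rewrite natrM exprMn.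
have e4 : (i ^ 2)%:R ^+ d = y by rewrite natrX -exprM.
have Td : T%:R ^+ d * T%:R <= a.
  by rewrite -exprSr; apply: ler_weXn2l => //; lia.
have aT : 1 <= a / T%:R.
  rewrite ler_pdivlMr // mul1r; apply: le_trans Td.
  by rewrite ler_peMl ?exprn_ege1 // ltW.
have Td' : T%:R ^+ d <= a / T%:R by rewrite ler_pdivlMr.
have e5 : (sample_size (i * T))%:R * (k%:R ^+ 2 * (2 * (d.+1%:R / (i ^ 2 * resolution T)%:R))) =
   y * (Cr * (a / T%:R ^+ 4)) :> R.
  have -> : sample_size (i * T) = (i ^ (2 * d) * i ^ 2 * (T ^ (2 * d) * T ^ 2))%N.
    by rewrite /sample_size expnMn mulnS addnC !expnD.
  rewrite /Cr /resolution !natrM !natrX -/y -/a.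
  by field; rewrite !gt_eqF.
have h3 : a / T%:R ^+ 4 <= a / T%:R.
  rewrite ler_wpM2l ?(ltW ap) // lef_pV2 ?posrE ?exprn_gt0 //.
  by rewrite exprS ler_peMr ?exprn_ege1 // ltW.
have e6 : T%:R ^+ d + (T ^ d.+1)%:R / T%:R = 2 * T%:R ^+ d :> R.
  rewrite natrX exprSr mulfK ?gt_eqF //; ring.
rewrite e5 in h2; rewrite e4 e6 in h1.
have -> : (sample_mean T / a + C2 / T%:R) * (y * a) = y * (sample_mean T + C2 * (a / T%:R)).
  by field; rewrite !gt_eqF.
apply: (@le_trans _ _ (y * (sample_mean T + smooth_const R d k * (2 * T%:R ^+ d) + subadd_const R d k) +
    y * (Cr * (a / T%:R ^+ 4)))).
  move: h2; rewrite ler_distl => /andP[_ h2]; apply: le_trans h2 _.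
  by rewrite lerD2r.
rewrite -mulrDr ler_wpM2l ?(ltW yp) // -!addrA lerD2l /C2.
have c0 := smooth_const_ge0 R d k.
have c1 : 0 <= subadd_const R d k by rewrite /subadd_const mulr_ge0 ?sqr_ge0.
have g1 := ler_wpM2l c0 Td'.
have g2 := ler_wpM2l c1 aT.
have g3 := ler_wpM2l Cr_ge0 h3.
lra.
Qed.

(** The grids for [j] and [j.+1] do not refine each other, so both means are moved to the product
    grid; only there are the sample sizes compared. *)
Lemma sample_mean_diff j A : (0 < j)%N -> (0 < A)%N ->
  `|sample_mean j.+1 - sample_mean j| <=
  Cr * (j.+1%:R ^+ (2 * d) / j%:R) + Cr * (j%:R ^+ (2 * d) / j%:R) +
  smooth_const R d k * ((A * j)%:R ^+ d + ((sample_size j.+1)%:R - (sample_size j)%:R) / (A * j)%:R).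
Proof.
move=> j0 A0; have jp : 0 < j%:R :> R by rewrite ltr0n.
have hA : (0 < A * j)%N by rewrite muln_gt0 A0.
have j'0 : (0 < j.+1)%N by [].
have h1 := grid_mean_refine R d E k_gt0 (sample_size j.+1) (resolution_gt0 j'0) (resolution_gt0 j0).
have h2 := grid_mean_refine R d E k_gt0 (sample_size j) (resolution_gt0 j0) (resolution_gt0 j'0).
have hN : (0 < resolution j * resolution j.+1)%N by rewrite muln_gt0 !resolution_gt0.
have h3 := grid_mean_smooth R d E k_gt0 (sample_size j.+1) (sample_size j) hN hA.
have nn : (sample_size j)%:R <= (sample_size j.+1)%:R :> R by rewrite ler_nat leq_exp2r.
rewrite [ `|(sample_size _)%:R - _| ]ger0_norm ?subr_ge0 // in h3.
rewrite [(resolution j.+1 * _)%N]mulnC in h1.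
have g1 : (sample_size j.+1)%:R * (k%:R ^+ 2 * (2 * (d.+1%:R / (resolution j.+1)%:R))) <=
    Cr * (j.+1%:R ^+ (2 * d) / j%:R).
  have -> : (sample_size j.+1)%:R * (k%:R ^+ 2 * (2 * (d.+1%:R / (resolution j.+1)%:R))) =
     Cr * ((sample_size j.+1)%:R / (resolution j.+1)%:R) by rewrite /Cr; ring.
  rewrite ler_wpM2l // (le_trans (sample_size_resolution j'0)) //.
  by rewrite ler_wpM2l ?exprn_ge0 // lef_pV2 ?posrE ?ltr0n // ler_nat.
have g2 : (sample_size j)%:R * (k%:R ^+ 2 * (2 * (d.+1%:R / (resolution j)%:R))) <=
    Cr * (j%:R ^+ (2 * d) / j%:R).
  have -> : (sample_size j)%:R * (k%:R ^+ 2 * (2 * (d.+1%:R / (resolution j)%:R))) =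
     Cr * ((sample_size j)%:R / (resolution j)%:R) by rewrite /Cr; ring.
  by rewrite ler_wpM2l // sample_size_resolution.
move: h1 h2 h3; rewrite /sample_mean !ler_norml => /andP[? ?] /andP[? ?] /andP[? ?].
by apply/andP; split; lra.
Qed.

Lemma scaled_mean_diff e : 0 < e ->
  exists J, forall j, (J <= j)%N -> `|scaled_mean j.+1 - scaled_mean j| <= e.
Proof.
move=> e0; have e2 : 0 < e / 2 by rewrite divr_gt0.
have [A A0 [J J0 hJ]] := gap_small (smooth_const_ge0 R d k) d_gt0 e2.
pose c := 2 * Cr + mean_const * 2 ^+ (2 * d).
have [J' hJ'] := tends_harmonic c e2.
exists (J + J')%N => j hj.
have j0 : (0 < j)%N by lia.
have jp : 0 < j%:R :> R by rewrite ltr0n.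
have j1 : 1 <= j%:R :> R by rewrite ler1n.
have /hJ h1 : (J <= j)%N by lia.
have /hJ' h2 : (J' <= j)%N by lia.
have h3 := sample_mean_diff j0 A0.
have h4 := exprn_gap (2 * d) j1; rewrite natr1 in h4.
have h5 := sample_mean_le j0.
have h6 : 0 <= sample_mean j by rewrite grid_mean_ge0 ?resolution_gt0.
rewrite subr0 in h2; have {}h2 := le_trans (ler_norm _) h2.
rewrite /scaled_mean; move: h1 h3 h4 h5; rewrite -/(sample_size j.+1) -/(sample_size j).
set G := smooth_const R d k * _; set a := j%:R ^+ (2 * d); set a' := j.+1%:R ^+ (2 * d).
set m := sample_mean j; set m' := sample_mean j.+1 => h1 h3 h4 h5.
have ap : 0 < a by rewrite exprn_gt0.
have ap' : 0 < a' by rewrite exprn_gt0 ?ltr0n.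
have aa' : a <= a' by rewrite /a /a' lerXn2r ?nnegrE ?ler_nat.
have ij : 0 < j%:R^-1 :> R by rewrite invr_gt0.
(* This separates the change of the mean from that of the normalization; the latter is multiplied
   only by the bounded ratio [m / a]. *)
have -> : m' / a' - m / a = ((m' - m) - (m / a) * (a' - a)) / a'.
  by field; rewrite !gt_eqF.
rewrite normrM [ `|a'^-1| ]ger0_norm ?invr_ge0 ?(ltW ap') // ler_pdivrMr //.
apply: le_trans (ler_normB _ _) _.
have ma : m / a <= mean_const by rewrite ler_pdivrMr.
have ma0 : 0 <= m / a by rewrite divr_ge0 // ltW.
have g1 : `|m / a * (a' - a)| <= mean_const * (2 ^+ (2 * d) * a / j%:R).
  have d0 : 0 <= a' - a by rewrite subr_ge0.
  rewrite (ger0_norm (mulr_ge0 ma0 d0)).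
  by apply: ler_pM => //; rewrite lerBlDl.
have g2 : mean_const * (2 ^+ (2 * d) * a / j%:R) <= mean_const * (2 ^+ (2 * d) * (a' / j%:R)).
  rewrite ler_wpM2l ?mean_const_ge0 // -mulrA ler_wpM2l ?exprn_ge0 //.
  by rewrite ler_wpM2r ?(ltW ij).
have g3 : Cr * (a / j%:R) <= Cr * (a' / j%:R).
  by rewrite ler_wpM2l // ler_wpM2r ?(ltW ij).
have g4 : a * (e / 2) <= a' * (e / 2) by rewrite ler_wpM2r ?(ltW e2).
have g5 : a' * (c / j%:R) <= a' * (e / 2) by rewrite ler_wpM2l ?(ltW ap').
have g6 : a' * (c / j%:R) = Cr * (a' / j%:R) + Cr * (a' / j%:R) + mean_const * (2 ^+ (2 * d) * (a' / j%:R)).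
  by rewrite /c; ring.
lra.
Qed.

Lemma scaled_mean_tends : exists b, tends scaled_mean b.
Proof.
apply: (@near_subadditive_tends _ _ C2).
- have c1 : 0 <= subadd_const R d k by rewrite /subadd_const mulr_ge0 ?sqr_ge0.
  by rewrite /C2; do 2 apply: addr_ge0 => //; apply: mulr_ge0; rewrite ?smooth_const_ge0.
- exact: scaled_mean_ge0.
- exact: scaled_mean_mul.
- exact: scaled_mean_diff.
Qed.
End Gamma.

(** * Concentration *)

Lemma hamming_perm (T : eqType) (s t : seq T) : size s = size t -> exists u v v',
  [/\ perm_eq s (u ++ v), perm_eq t (u ++ v'), size v = hamming s t & size v' = hamming s t].
Proof.
elim: s t => [|x s IH] [|y t] //=; first by exists [::], [::], [::].
move=> [/IH [u [v [v' [h1 h2 h3 h4]]]]]; case: (eqVneq x y) => [<-|xy].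
  by exists (x :: u), v, v'; rewrite /= !perm_cons.
exists u, (x :: v), (y :: v'); rewrite /= h3 h4 add1n; split=> //.
  by rewrite perm_sym -cat1s perm_catCA /= perm_cons perm_sym.
by rewrite perm_sym -cat1s perm_catCA /= perm_cons perm_sym.
Qed.

Section Concentration.
Variables (R : realType) (G : finType) (hG : (0 < #|G|)%N).

(* The infimal convolution of [F] with [K * hamming] is [K]-Lipschitz and differs
   from [F] by at most [a]. *)
Lemma expect_concentration n (F : seq G -> R) (a K e : R) :
  0 <= a -> 0 <= K -> 0 < e ->
  (forall s t, size s = n -> size t = n -> `|F s - F t| <= a + K * (hamming s t)%:R) ->
  expect n (fun s => (e + 2 * a < `|F s - expect n F|)%R%:R) <= n%:R * K ^+ 2 / e ^+ 2.
Proof.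
move=> a0 K0 e0 hF.
pose F' s := \big[Num.min/F s]_(t : n.-tuple G) (F t + K * (hamming s t)%:R).
have F'F s : F' s <= F s by apply: bigmin_le_id.
have F'le s t : size t = n -> F' s <= F t + K * (hamming s t)%:R.
  move=> ht; apply: (@bigmin_le_cond _ _ _ _ (Tuple (introT eqP ht)) xpredT
    (fun t : n.-tuple G => F t + K * (hamming s t)%:R)).
  by [].
have FF' s : size s = n -> F s - a <= F' s.
  move=> hs; apply: le_bigmin; first by rewrite gerBl.
  move=> t _; have := hF s t hs (size_tuple t).
  by rewrite ler_distl => /andP[_]; lra.
have lipF' : lipschitz n K F'.
  suff h s t : size s = n -> size t = n -> F' s <= F' t + K * (hamming s t)%:R.
    by move=> s t hs ht; rewrite ler_distl lerBlDr h // hamming_sym h.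
  move=> hs ht; rewrite -lerBlDr; apply: le_bigmin.
    by rewrite lerBlDr F'le.
  move=> v _; rewrite lerBlDr; apply: le_trans (F'le s v (size_tuple v)) _.
  rewrite -addrA lerD2l -mulrDr ler_wpM2l // -natrD ler_nat addnC.
  exact: (hamming_triangle (etrans hs (esym ht)) (etrans ht (esym (size_tuple v)))).
have dEX : `|expect n F - expect n F'| <= a.
  apply: (expect_dist hG) => s hs; have h1 := F'F s; have h2 := FF' s hs.
  by rewrite ler_norml; apply/andP; split; lra.
(* Of the slack [2 * a], one [a] pays for replacing [F] by its regularization and the other for
   replacing its mean. *)
apply: le_trans (expect_chebyshev hG K0 e0 lipF').
apply: expect_le => s hs; rewrite ler_nat.
case: (ltP (e + 2 * a)) => //= h; rewrite lt0b; apply: contraLR h.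
rewrite -!leNgt => h.
have d1 : `|F s - F' s| <= a.
  have h1 := F'F s; have h2 := FF' s hs.
  by rewrite ler_norml; apply/andP; split; lra.
move: h d1 dEX; rewrite !ler_norml => /andP[? ?] /andP[? ?] /andP[? ?].
by apply/andP; split; lra.
Qed.
End Concentration.

Section LConcentration.
Variables (R : realType) (d k : nat) (E : rel 'I_k).
Hypotheses (k_gt0 : (0 < k)%N) (d_gt0 : (0 < d)%N).

Lemma grid_cost_concentration e : 0 < e -> exists2 C, 0 <= C & exists2 J, (0 < J)%N &
  forall j, (J <= j)%N ->
  expect (sample_size d j) (fun s : seq {ffun 'I_d.+1 -> 'I_(resolution j)} =>
    (e * j%:R ^+ (2 * d) < `|grid_cost R E s - sample_mean R d E j|)%R%:R) <= C / j%:R ^+ 2 :> R.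
Proof.
move=> e0; have c0 := smooth_const_ge0 R d k.
(* Chosen so that B exceeds 4 [smooth_const] / e, which makes [smooth_const] M^d at most e j^(2d) /
   4. *)
pose B := (Num.truncn (4 * smooth_const R d k / e)).+1.
have Bp : 0 < B%:R :> R by rewrite ltr0n.
pose C := (4 * smooth_const R d k * B%:R) ^+ 2 * 4 / e ^+ 2.
exists C; first by rewrite divr_ge0 ?sqr_ge0 // mulr_ge0 ?sqr_ge0.
exists B => // j hj.
have j0 : (0 < j)%N by apply: leq_trans hj.
have jp : 0 < j%:R :> R by rewrite ltr0n.
pose M := (j ^ 2 %/ B)%N.
have Bj : (B <= j ^ 2)%N by rewrite expnS expn1; nia.
have M0 : (0 < M)%N by rewrite divn_gt0.
have Mp : 0 < M%:R :> R by rewrite ltr0n.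
have MB : (M * B <= j ^ 2)%N by rewrite leq_divM.
have jM : (j ^ 2 <= 2 * (M * B))%N.
  have := divn_eq (j ^ 2) B; have := ltn_pmod (j ^ 2) (ltn0Sn (Num.truncn (4 * smooth_const R d k / e))).
  rewrite -/B -/M; nia.
have MBr : M%:R * B%:R <= j%:R ^+ 2 :> R by rewrite -natrX -natrM ler_nat.
have jMr : j%:R ^+ 2 <= 2 * (M%:R * B%:R) :> R by rewrite -natrX -!natrM ler_nat.
set a := j%:R ^+ (2 * d).
have ap : 0 < a by rewrite exprn_gt0.
have hG := card_grid_gt0 d (resolution_gt0 j0).
have eB : 4 * smooth_const R d k <= e * B%:R.
  by rewrite [leRHS]mulrC -ler_pdivrMr // ltW // truncnS_gt.
have h1 : smooth_const R d k * M%:R ^+ d <= e * a / 4.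
  have h : M%:R ^+ d * B%:R <= a.
    apply: (@le_trans _ _ ((M%:R * B%:R) ^+ d)); last first.
      by rewrite /a exprM lerXn2r ?nnegrE ?sqr_ge0 ?mulr_ge0.
    by rewrite exprMn ler_wpM2l ?exprn_ge0 // ler_eXnr // ler1n.
  have g1 := ler_wpM2r (exprn_ge0 d (ltW Mp)) eB.
  have g2 := ler_wpM2l (ltW e0) h.
  by rewrite ler_pdivlMr //; lra.
pose K := 2 * smooth_const R d k / M%:R.
have K0 : 0 <= K by rewrite divr_ge0 ?mulr_ge0.
have hF (s t : seq {ffun 'I_d.+1 -> 'I_(resolution j)}) :
    size s = sample_size d j -> size t = sample_size d j ->
    `|grid_cost R E s - grid_cost R E t| <= smooth_const R d k * M%:R ^+ d + K * (hamming s t)%:R.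
  move=> hs ht; have [|u [v [v' [p1 p2 z1 z2]]]] := @hamming_perm _ s t.
    by rewrite hs ht.
  have := @min_cost_smooth_abs R d k E k_gt0 M (map (@grid_point R d _) s) (map (@grid_point R d _) t)
    (map (@grid_point R d _) u) (map (@grid_point R d _) v) (map (@grid_point R d _) v') M0
    (all_grid_point_incube _ _) (all_grid_point_incube _ _).
  rewrite -!map_cat !perm_map // !size_map z1 z2 => /(_ isT isT).
  move/le_trans; apply; rewrite /K natrD le_eqVlt; apply/orP; left; apply/eqP.
  by field; rewrite gt_eqF.
have a0 : 0 <= smooth_const R d k * M%:R ^+ d by rewrite mulr_ge0 ?exprn_ge0.
have e2 : 0 < e * a / 2 by rewrite divr_gt0 ?mulr_gt0.
have := expect_concentration hG a0 K0 e2 hF.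
rewrite -/(grid_mean R d E (sample_size d j) (resolution j)) -/(sample_mean R d E j) => h.
apply: (@le_trans _ _ ((sample_size d j)%:R * K ^+ 2 / (e * a / 2) ^+ 2)).
  apply: le_trans h; apply: expect_le => s _; rewrite ler_nat.
  case: (ltP (e * a)) => //= h; rewrite lt0b; apply: le_lt_trans h; lra.
have KB : K <= 4 * smooth_const R d k * B%:R / j%:R ^+ 2.
  rewrite /K ler_pdivrMr // mulrAC ler_pdivlMr ?exprn_gt0 //.
  have := ler_wpM2l c0 jMr; lra.
have KB2 : K ^+ 2 <= (4 * smooth_const R d k * B%:R) ^+ 2 / j%:R ^+ 4.
  have -> : (4 * smooth_const R d k * B%:R) ^+ 2 / j%:R ^+ 4 =
     (4 * smooth_const R d k * B%:R / j%:R ^+ 2) ^+ 2 by field; rewrite gt_eqF.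
  by rewrite ler_pXn2r ?nnegrE // (le_trans K0).
have nE : (sample_size d j)%:R = a * j%:R ^+ 2 :> R.
  by rewrite /sample_size natrX mulnS addnC exprD.
rewrite nE ler_pdivrMr ?exprn_gt0 //.
apply: (@le_trans _ _ (a * j%:R ^+ 2 * ((4 * smooth_const R d k * B%:R) ^+ 2 / j%:R ^+ 4))).
  by rewrite ler_wpM2l ?mulr_ge0 ?sqr_ge0 // ltW.
have -> : a * j%:R ^+ 2 * ((4 * smooth_const R d k * B%:R) ^+ 2 / j%:R ^+ 4) =
  ((4 * smooth_const R d k * B%:R) ^+ 2 / j%:R ^+ 2) * a by field; rewrite gt_eqF.
have -> : C / j%:R ^+ 2 * (e * a / 2) ^+ 2 =
  ((4 * smooth_const R d k * B%:R) ^+ 2 / j%:R ^+ 2) * (a * a).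
  by rewrite /C; field; rewrite !gt_eqF.
rewrite ler_wpM2l ?divr_ge0 ?sqr_ge0 // ler_peMl ?(ltW ap) //.
by rewrite exprn_ege1 // ler1n.
Qed.

End LConcentration.

(** * Lower bound for stars *)

Section LowerBound.
Variables (R : realType) (d k' : nat) (E : rel 'I_k'.+1).
Hypothesis star : forall v, v != ord0 -> E ord0 v.
Local Notation k := k'.+1.
Local Notation grid N := {ffun 'I_d.+1 -> 'I_N}.

(** Only the edges at the centre, the first point of the chunk, are kept. *)
Lemma chunk_cost_star (n : nat) (x : n.-tuple R) (l : seq (n.-tuple R)) :
  size l = k' -> \sum_(y <- l) eucl_dist x y <= chunk_cost E (x :: l).
Proof.
move=> hl; rewrite /chunk_cost -(pair_big_dep xpredT
  (fun u v : 'I_k => (u < v)%N && E u v) (fun u v =>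
    eucl_dist (nth (origin R n) (x :: l) u) (nth (origin R n) (x :: l) v))) /=.
rewrite (bigD1 ord0) //= [X in _ <= X + _]big_mkcond big_ord_recl ltnn /= add0r.
rewrite (big_nth (origin R n)) hl big_mkord.
under [X in _ <= X + _]eq_bigr => i _ do rewrite star //=.
rewrite lerDl; apply: sumr_ge0 => u _; apply: sumr_ge0 => v _.
exact: eucl_dist_ge0.
Qed.

Definition near_cell M (q q' : grid M) : bool :=
  [forall j, (q j <= (q' j).+1)%N && (q' j <= (q j).+1)%N].

(** In each coordinate the offset plus 1 lies in {0, 1, 2}, and these values determine the
    neighbour. *)
Lemma card_near_cell M (q : grid M) : (#|[pred q' | near_cell q q']| <= 3 ^ d.+1)%N.
Proof.
pose f (q' : grid M) : grid 3 := [ffun j => inord ((q' j).+1 - q j)].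
have fi : {in [pred q' | near_cell q q'] &, injective f}.
  move=> q1 q2 /forallP h1 /forallP h2 /ffunP e; apply/ffunP => j; apply: val_inj.
  have := congr1 (@nat_of_ord _) (e j); rewrite !ffunE.
  have /andP[a1 a2] := h1 j; have /andP[b1 b2] := h2 j.
  by rewrite !inordK /=; lia.
rewrite -(card_in_image fi) -(card_grid d 3); exact: max_card.
Qed.

(** In some coordinate the two cell indices differ by at least 2, so a whole cell of width 1/M lies
    between the points. *)
Lemma dist_far M N (p p' : grid M * grid N) : (0 < N)%N ->
  ~~ near_cell p.1 p'.1 ->
  M%:R^-1 <= eucl_dist (grid_point R (join p)) (grid_point R (join p')).
Proof.
move=> N0; rewrite negb_forall => /existsP[j hj].
have M0 : (0 < M)%N by apply: leq_ltn_trans (ltn_ord (p.1 j)).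
have Mp : 0 < M%:R :> R by rewrite ltr0n.
have frac (c : grid N) : 0 <= tnth (grid_point R c) j <= 1.
  exact: (forallP (grid_point_incube R c) j).
have /andP[c0 c1] := frac p.2; have /andP[c0' c1'] := frac p'.2.
apply: le_trans (eucl_dist_ge_coord _ _ j).
rewrite !grid_point_join // -mulrBl normrM [ `|M%:R^-1| ]ger0_norm ?invr_ge0 //.
rewrite ler_peMl ?invr_ge0 //.
have : ((p'.1 j).+2 <= p.1 j)%N || ((p.1 j).+2 <= p'.1 j)%N by lia.
case/orP => h; have : ((p'.1 j) + 2)%:R <= (p.1 j)%:R :> R \/ ((p.1 j) + 2)%:R <= (p'.1 j)%:R :> R.
- by left; rewrite ler_nat addn2.
- move=> _; have : ((p'.1 j) + 2)%:R <= (p.1 j)%:R :> R by rewrite ler_nat addn2.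
  by rewrite natrD => g; rewrite ger0_norm; lra.
- by right; rewrite ler_nat addn2.
- move=> _; have : ((p.1 j) + 2)%:R <= (p'.1 j)%:R :> R by rewrite ler_nat addn2.
  by rewrite natrD => g; rewrite ler0_norm; lra.
Qed.

Section Counting.
Variables (M N lam : nat).
Hypothesis N0 : (0 < N)%N.
Local Notation pair := (grid M * grid N)%type.
Variable s : seq pair.

Let occ (Q : grid M) := count_mem Q (map fst s).
Let heavy (p : pair) := (2 * lam < occ p.1)%N.
(** The number of sample points in crowded cells, those with more than [2 * lam] points; [lam] will
    be the mean number per cell. *)
Definition overload : nat :=
  \sum_(Q : grid M) (if (2 * lam < count_mem Q (map fst s))%N
                     then count_mem Q (map fst s) else 0).

Lemma count_cells (T : finType) (P : pred T) (t : seq T) :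
  count P t = \sum_(Q | P Q) count_mem Q t.
Proof.
elim: t => [|x t IH] /=; first by rewrite big1.
rewrite IH big_split /=; congr (_ + _)%N.
case: (boolP (P x)) => Px.
  by rewrite (bigD1 x) //= eqxx big1 ?addn0 // => Q /andP[_ /negbTE]; rewrite eq_sym => ->.
rewrite big1 // => Q PQ; case: eqP => // xQ.
by rewrite xQ PQ in Px.
Qed.

Lemma count_heavy : count heavy s = overload.
Proof.
rewrite /overload -big_mkcond /= -count_cells count_map.
by apply: eq_count.
Qed.

Lemma count_near_light (x : pair) :
  (count (fun p => near_cell x.1 p.1 && ~~ heavy p) s <= 3 ^ d.+1 * (2 * lam))%N.
Proof.
have -> : count (fun p => near_cell x.1 p.1 && ~~ heavy p) s =
  count (fun q => near_cell x.1 q && (occ q <= 2 * lam)%N) (map fst s).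
  by rewrite count_map; apply: eq_count => p /=; rewrite /heavy -leqNgt.
rewrite count_cells.
apply: (@leq_trans (\sum_(Q | near_cell x.1 Q) 2 * lam)).
  rewrite big_mkcondr /=; apply: leq_sum => Q _.
  by case: ifP.
by rewrite sum_nat_const leq_mul2r card_near_cell orbT.
Qed.

Let F (p : pair) := grid_point R (join p).

(** Of the k' leaves of a star, at most 3^(d+1) 2 lam lie near the centre in uncrowded cells. Every
    other leaf lies in a crowded cell or has an edge of length at least 1/M. The chunks are
    disjoint, so the leaves in crowded cells are paid for once, by [overload]. *)
Lemma factor_cost_overload c : factor_costs E (map F s) c -> (3 ^ d.+1 * (2 * lam) <= k')%N ->
  ((size s)%:R / k%:R - 1) * (k'%:R - (3 ^ d.+1 * (2 * lam))%:R) - overload%:R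
   <= M%:R * c.
Proof.
move=> /factor_costs_lift [cs [rest [h1 h2 h3 ->]]] hB.
set B := (3 ^ d.+1 * (2 * lam))%N.
have hcs : (size s <= size cs * k + k)%N.
  rewrite (perm_size h1) size_cat; apply: leq_add (ltnW h3).
  elim: cs {h1} h2 => //= c0 cs IH /andP[/eqP hc /IH].
  by rewrite size_cat hc mulSn leq_add2l.
have hchunk c0 : c0 \in cs ->
    k'%:R - B%:R - (count heavy c0)%:R <= M%:R * chunk_cost E (map F c0).
  move=> c0cs; have := allP h2 _ c0cs; case: c0 c0cs => [//|x l] c0cs /eqP [hl].
  have sub a : (count a (x :: l) <= count a s)%N.
    rewrite (permP h1) count_cat (permP (perm_flatten (perm_to_rem c0cs))) /=.
    by rewrite !count_cat /=; lia.
  pose far (p : pair) := ~~ near_cell x.1 p.1.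
  have hk : (k' <= count far l + B + count heavy (x :: l))%N.
    have := leq_trans (sub _) (count_near_light x); rewrite -/B /=.
    set A := count (fun p => near_cell x.1 p.1 && ~~ heavy p) l => hA.
    have : (size l <= count far l + A + count heavy l)%N.
      rewrite /A /far; elim: (l) => //= y l' IH.
      by case: (near_cell x.1 y.1); case: (heavy y) => /=; lia.
    by rewrite hl; lia.
  have : k'%:R <= (count far l)%:R + B%:R + (count heavy (x :: l))%:R :> R.
    by rewrite -!natrD ler_nat.
  suff : (count far l)%:R <= M%:R * chunk_cost E (map F (x :: l)) by lra.
  have M0 : (0 < M)%N by apply: leq_ltn_trans (ltn_ord (x.1 ord0)).
  have Mp : 0 < M%:R :> R by rewrite ltr0n.
  rewrite -ler_pdivrMl //.
  apply: le_trans (chunk_cost_star (F x) (l := map F l) _); last by rewrite size_map.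
  rewrite big_map; elim: (l) => [|y l' IH] /=; first by rewrite mulr0 big_nil.
  rewrite big_cons natrD mulrDr lerD //.
  case: (boolP (far y)) => fy; last by rewrite mulr0 eucl_dist_ge0.
  by rewrite mulr1; apply: dist_far.
have hsum : (size cs)%:R * (k'%:R - B%:R) - (count heavy (flatten cs))%:R <=
    M%:R * total_cost E (map (map F) cs).
  elim: cs {h1 h2 hcs} hchunk => [|c0 cs IH] hc.
    by rewrite /total_cost big_nil /= mulr0 mul0r subrr.
  have hc' c1 : c1 \in cs ->
      k'%:R - B%:R - (count heavy c1)%:R <= M%:R * chunk_cost E (map F c1).
    by move=> h; apply: hc; rewrite inE h orbT.
  have := IH hc'; have := hc c0 (mem_head _ _).
  rewrite /total_cost /= big_cons count_cat natrD -[(size cs).+1%:R]natr1; lra.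
have hov : (count heavy (flatten cs))%:R <= overload%:R :> R.
  rewrite ler_nat -count_heavy (permP h1) count_cat; exact: leq_addr.
have hB' : 0 <= k'%:R - B%:R :> R by rewrite subr_ge0 ler_nat.
have : (size s)%:R / k%:R - 1 <= (size cs)%:R :> R.
  rewrite lerBlDr ler_pdivrMr ?ltr0n // mulrDl mul1r -natrM -natrD ler_nat.
  exact: hcs.
by move=> h; apply: le_trans hsum; apply: lerB => //; apply: ler_wpM2r.
Qed.
End Counting.

(** A count x > 2 lam satisfies x <= (2/lam) (x - lam)^2, and the variance of a count is at most
    lam; so each cell contributes at most 2. *)
Lemma expect_overload M N lam : (0 < M)%N -> (0 < N)%N -> (0 < lam)%N ->
  expect (lam * M ^ d.+1) (fun s : seq (grid M * grid N) => (overload lam s)%:R : R)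
    <= 2 * (M ^ d.+1)%:R.
Proof.
move=> M0 N0 l0; have hG := card_grid_gt0 d M0.
have lp : 0 < lam%:R :> R by rewrite ltr0n.
set n := (lam * _)%N.
rewrite (expect_fst n (fun q : seq (grid M) => (\sum_(Q : grid M) (if (2 * lam < count_mem Q q)%N
                     then count_mem Q q else 0))%:R : R)) ?card_grid_gt0 //.
apply: (@le_trans _ _ (expect n (fun q => \sum_(Q : grid M)
    2 / lam%:R * ((count_mem Q q)%:R + - lam%:R) ^+ 2 : R))).
  apply: expect_le => q _; rewrite natr_sum; apply: ler_sum => Q _.
  set x := count_mem Q q; case: ltnP => [h|_]; last first.
    by rewrite mulr_ge0 ?sqr_ge0 // divr_ge0.
  have : 2 * lam%:R <= x%:R :> R by rewrite -natrM ler_nat ltnW.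
  move=> hx; rewrite mulrAC ler_pdivlMr //.
  have : 0 <= x%:R - 2 * lam%:R :> R by rewrite subr_ge0.
  nra.
rewrite expect_sum //.
apply: (@le_trans _ _ (\sum_(Q : grid M) 2)).
  apply: ler_sum => Q _; rewrite expectZ expect_count_mem //.
  have np : n%:R * #|grid M|%:R^-1 = lam%:R :> R.
    rewrite card_grid /n natrM mulfK // pnatr_eq0 -lt0n expn_gt0 M0 //.
  have p0 : 0 <= #|grid M|%:R^-1 :> R by rewrite invr_ge0.
  rewrite np; set p := #|grid M|%:R^-1 in p0 *.
  have -> : 2 / lam%:R * (lam%:R * (1 - p) + (lam%:R + - lam%:R) ^+ 2) = 2 * (1 - p).
    by field; rewrite gt_eqF.
  lra.
by rewrite sumr_const card_grid mulr_natr.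
Qed.

(** The bound on [k] keeps at least three quarters of the n possible long edges, up to [k];
    [8 <= lam] limits the mean overload to n/4. *)
Lemma grid_mean_lower M N lam : (0 < M)%N -> (0 < N)%N -> (8 <= lam)%N ->
  (4 * (1 + 3 ^ d.+1 * (2 * lam)) <= k)%N ->
  (lam * M ^ d.+1)%:R / 2 - k%:R <=
    M%:R * grid_mean R d E (lam * M ^ d.+1) (M * N).
Proof.
move=> M0 N0 l8 hk; set n := (lam * _)%N; set B := (3 ^ d.+1 * (2 * lam))%N in hk.
have hG : (0 < #|{: grid M * grid N}|)%N.
  by rewrite card_prod muln_gt0 !card_grid_gt0.
rewrite /grid_mean (expect_bij n _ (join_bij d M N)) -expectZ.
have kp : 0 < k%:R :> R by rewrite ltr0n.
have l0 : (0 < lam)%N by apply: leq_trans l8.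
have Bk : (B <= k')%N by rewrite /B in hk *; lia.
pose c : R := (n%:R / k%:R - 1) * (k'%:R - B%:R).
apply: (@le_trans _ _ (expect n (fun s : seq (grid M * grid N) =>
    c + -1 * (overload lam s)%:R))); last first.
  apply: expect_le => s hs; rewrite /grid_cost -map_comp.
  have Mp : 0 < M%:R :> R by rewrite ltr0n.
  rewrite -ler_pdivrMl //; apply: le_min_cost => // cc hcc.
  have := factor_cost_overload N0 hcc Bk; rewrite hs mulN1r -/c ler_pdivrMl //.
rewrite expectD expect_cst // expectZ mulN1r.
have := expect_overload M0 N0 l0; rewrite -/n => h.
have h2 : (2 * (M ^ d.+1)%:R) <= n%:R / 4 :> R.
  have : 8 * (M ^ d.+1)%:R <= n%:R :> R by rewrite -natrM ler_nat leq_mul2r l8 orbT.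
  lra.
have h3 : n%:R * 3 / 4 - k%:R <= c.
  have e1 : k%:R = k'%:R + 1 :> R by rewrite -natr1.
  have e2 : 4 * (1 + B%:R) <= k%:R :> R 
    by rewrite -[1]/(1%:R) -natrD -natrM ler_nat.
  have n0 : 0 <= n%:R / k%:R :> R by rewrite divr_ge0.
  have -> : c = n%:R - n%:R / k%:R * (1 + B%:R) - k%:R + (1 + B%:R).
    by rewrite /c e1; field; rewrite -e1 gt_eqF.
  have : n%:R / k%:R * (4 * (1 + B%:R)) <= n%:R / k%:R * k%:R :> R
    by rewrite ler_wpM2l.
  rewrite divfK ?gt_eqF //; set w : R := n%:R / k%:R.
  have : 0 <= B%:R :> R by [].
  lra.
lra.
Qed.

(** Cells with M = b i^2 and lam = b^(d+1) give exactly [sample_size (b * i)] points. The cell width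
    1/M is then b n^(-1/(d+1)), so half of n edges of this length cost b/2 after normalization. *)
Lemma scaled_mean_lower b i : (8 <= b)%N -> (0 < i)%N ->
  (4 * (1 + 3 ^ d.+1 * (2 * b ^ d.+1)) <= k)%N ->
  b%:R / 2 - (k%:R * b%:R) / i%:R <= scaled_mean R d E (b * i).
Proof.
move=> b8 i0 hk.
have b0 : (0 < b)%N by apply: leq_trans b8.
have bp : 0 < b%:R :> R by rewrite ltr0n.
have ip : 0 < i%:R :> R by rewrite ltr0n.
have i1 : 1 <= i%:R :> R by rewrite ler1n.
have b1 : 1 <= b%:R :> R by rewrite ler1n.
have M0 : (0 < b * i ^ 2)%N by rewrite muln_gt0 b0 expn_gt0 i0.
have N0 : (0 < b ^ 5 * i ^ 4)%N by rewrite muln_gt0 !expn_gt0 b0 i0.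
have l8 : (8 <= b ^ d.+1)%N.
  by apply: leq_trans b8 _; rewrite -[X in (X <= _)%N]expn1 leq_pexp2l.
have := grid_mean_lower M0 N0 l8 hk.
have -> : (b * i ^ 2 * (b ^ 5 * i ^ 4))%N = resolution (b * i) by rewrite /resolution expnMn; lia.
have -> : (b ^ d.+1 * (b * i ^ 2) ^ d.+1)%N = sample_size d (b * i).
  by rewrite /sample_size expnM -expnMn; congr (_ ^ _)%N; rewrite expnMn mulnA.
rewrite -/(sample_mean R d E (b * i)) => h.
rewrite /scaled_mean; set a : R := (b * i)%:R ^+ (2 * d).
have a1 : 1 <= a by rewrite exprn_ege1 // ler1n muln_gt0 b0.
have ap : 0 < a by exact: lt_le_trans a1.
rewrite ler_pdivlMr //.
have nE : (sample_size d (b * i))%:R = a * (b%:R * i%:R) ^+ 2 :> R.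
  by rewrite /sample_size natrX mulnS addnC exprD -/a natrM.
have ME : (b * i ^ 2)%:R = (b%:R * i%:R) ^+ 2 / b%:R :> R.
  by rewrite natrM natrX; field; rewrite gt_eqF.
move: h; rewrite nE ME; set q := (b%:R * i%:R) ^+ 2.
have qp : 0 < q by rewrite exprn_gt0 // mulr_gt0.
move=> h; apply: (@le_trans _ _ ((a * q / 2 - k%:R) * b%:R / q)); last first.
  rewrite ler_pdivrMr // -ler_pdivlMr //; apply: le_trans h _.
  by rewrite mulrAC [q * _]mulrC.
have -> : (a * q / 2 - k%:R) * b%:R / q = b%:R / 2 * a - k%:R * b%:R / q.
  by field; rewrite gt_eqF.
have iq : i%:R <= q.
  rewrite /q exprMn -[leLHS]mul1r; apply: ler_pM => //.
    by rewrite exprn_ege1.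
  by rewrite expr2 ler_peMl // ltW.
have h1 : k%:R * b%:R / q <= k%:R * b%:R / i%:R :> R.
  by rewrite ler_wpM2l // lef_pV2.
have h2 : k%:R * b%:R / i%:R <= k%:R * b%:R / i%:R * a :> R.
  by rewrite ler_peMr // divr_ge0.
by rewrite mulrBl; apply: lerB => //; apply: le_trans h2.
Qed.
End LowerBound.

(** * Almost sure convergence *)

Section Interpolation.
Variables (R : realType) (d k : nat) (E : rel 'I_k).
Hypotheses (k_gt0 : (0 < k)%N) (d_gt0 : (0 < d)%N).
Variable X : nat -> d.+1.-tuple R.
Hypothesis X_cube : forall i, incube (X i).

Definition initial_points n := [seq X i | i <- iota 0 n].

Lemma size_initial_points n : size (initial_points n) = n.
Proof. by rewrite size_map size_iota. Qed.

Definition cells N (N0 : (0 < N)%N) n := map (cell_of N0) (initial_points n).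

Lemma pre_all_incube n : all incube (initial_points n).
Proof. by rewrite all_map; apply/allP => i _; apply: X_cube. Qed.

Lemma min_cost_cells N (N0 : (0 < N)%N) n :
  `|min_cost E (initial_points n) - grid_cost R E (cells N0 n)| <=
    n%:R * (k%:R ^+ 2 * (2 * (d.+1%:R / N%:R))).
Proof.
have h0 : 0 <= d.+1%:R / N%:R :> R by rewrite divr_ge0.
rewrite /grid_cost /cells -map_comp -{1}(map_id (initial_points n)) -[X in _ <= X%:R * _](size_initial_points n).
rewrite ler_distl lerBlDr; apply/andP; split; apply: min_cost_round => // y yp /=.
  by rewrite eucl_distC dist_cell_of // (allP (pre_all_incube n)).
by rewrite dist_cell_of // (allP (pre_all_incube n)).
Qed.

Lemma min_cost_gap n n' M : (0 < M)%N -> (n <= n')%N ->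
  `|min_cost E (initial_points n') - min_cost E (initial_points n)| <=
    smooth_const R d k * (M%:R ^+ d + (n'%:R - n%:R) / M%:R).
Proof.
move=> M0 nn; have -> : n'%:R - n%:R = (size (map X (iota n (n' - n))) + 0)%:R :> R.
  by rewrite addn0 size_map size_iota natrB.
apply: (@min_cost_smooth_abs _ _ _ _ k_gt0 M _ _ (initial_points n) _ [::]) => //;
  rewrite ?pre_all_incube ?cats0 //.
by rewrite -map_cat -{1}[n]add0n -iotaD subnKC.
Qed.

Lemma pow_bracket n J : (sample_size d J <= n)%N -> exists j,
  [/\ (J <= j)%N, (sample_size d j <= n)%N & (n < sample_size d j.+1)%N].
Proof.
move=> hJ; have ub j : (sample_size d j <= n)%N -> (j <= n)%N.
  apply: leq_trans; case: j => // j.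
  by rewrite /sample_size -[X in (X <= _)%N]expn1 leq_pexp2l.
have [j hj hmax] := ex_maxnP (ex_intro (fun j => (sample_size d j <= n)%N) J hJ) ub.
exists j; split=> //; first exact: hmax.
by rewrite ltnNge; apply/negP => /hmax; rewrite ltnn.
Qed.

Lemma sample_size_powR j : (sample_size d j)%:R `^ (d%:R / d.+1%:R) = j%:R ^+ (2 * d) :> R.
Proof.
rewrite /sample_size natrX -powR_mulrn // -powRrM mulnC natrM.
have -> : d.+1%:R * 2 * (d%:R / d.+1%:R) = (2 * d)%:R :> R.
  by rewrite natrM; field; rewrite addrC natr1 pnatr_eq0.
by rewrite powR_mulrn.
Qed.

(** A general n is compared with the subsequence term j just below it. Five errors arise, each at
    most e/6 times j^(2d): the n - n_j extra points, rounding, deviation from the mean, convergence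
    of the means, and change of the normalization. *)
Lemma min_cost_tends b : tends (scaled_mean R d E) b ->
  (forall e : R, 0 < e -> exists J, forall j, (J <= j)%N ->
    forall N0 : (0 < resolution j)%N,
    `|grid_cost R E (cells N0 (sample_size d j)) - sample_mean R d E j| <= e * j%:R ^+ (2 * d)) ->
  tends (fun n => min_cost E (initial_points n) / (n%:R `^ (d%:R / d.+1%:R))) b.
Proof.
move=> gamb hconc e e0.
pose e' := e / 6.
have e'0 : 0 < e' by rewrite divr_gt0.
have [A A0 [J1 J10 hJ1]] := gap_small (smooth_const_ge0 R d k) d_gt0 e'0.
have [J2 hJ2] := hconc e' e'0.
have [J3 hJ3] := gamb e' e'0.
have [J4 hJ4] := tends_harmonic (k%:R ^+ 2 * (2 * d.+1%:R)) e'0.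
have [J5 hJ5] := tends_harmonic (`|b| * 2 ^+ (2 * d)) e'0.
pose J := (J1 + J2 + J3 + J4 + J5)%N.
exists (sample_size d J) => n /pow_bracket [j [Jj nj nj']].
have j0 : (0 < j)%N by rewrite /J in Jj; lia.
have {}hJ1 := hJ1 j ltac:(rewrite /J in Jj; lia).
have {}hJ2 := hJ2 j ltac:(rewrite /J in Jj; lia) (resolution_gt0 j0).
have {}hJ3 := hJ3 j ltac:(rewrite /J in Jj; lia).
have {}hJ4 := hJ4 j ltac:(rewrite /J in Jj; lia).
have {}hJ5 := hJ5 j ltac:(rewrite /J in Jj; lia).
have jp : 0 < j%:R :> R by rewrite ltr0n.
have j1 : 1 <= j%:R :> R by rewrite ler1n.
have hA : (0 < A * j)%N by rewrite muln_gt0 A0.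
have h1 := min_cost_gap hA nj.
have h2 := min_cost_cells (resolution_gt0 j0) (sample_size d j).
have h4 := exprn_gap (2 * d) j1; rewrite natr1 in h4.
rewrite subr0 in hJ4; have {}hJ4 := le_trans (ler_norm _) hJ4.
rewrite subr0 in hJ5; have {}hJ5 := le_trans (ler_norm _) hJ5.
set p := d%:R / d.+1%:R; have p0 : 0 <= p by rewrite divr_ge0.
have a1 : j%:R ^+ (2 * d) <= n%:R `^ p.
  by rewrite -sample_size_powR ge0_ler_powR ?nnegrE // ler_nat.
have a2 : n%:R `^ p <= j.+1%:R ^+ (2 * d).
  by rewrite -sample_size_powR ge0_ler_powR ?nnegrE // ler_nat ltnW.
have ap : 0 < j%:R ^+ (2 * d) :> R by rewrite exprn_gt0.
have nr := sample_size_resolution R d j0.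
move: hJ1 hJ2 hJ3 h1 h2 h4 a1 a2 nr; rewrite /scaled_mean -/(sample_size d j) -/(sample_size d j.+1).
set a := j%:R ^+ (2 * d) in ap *; set a' := j.+1%:R ^+ (2 * d); set y := n%:R `^ p.
set m := sample_mean R d E j; set Lg := grid_cost R E _.
set G := smooth_const R d k * _ => hJ1 hJ2 hJ3 h1 h2 h4 a1 a2 nr.
have yp : 0 < y by exact: lt_le_trans a1.
have g1 : `|min_cost E (initial_points n) - min_cost E (initial_points (sample_size d j))| <= a * e'.
  apply: le_trans hJ1; apply: le_trans h1 _; rewrite /G.
  rewrite ler_wpM2l ?smooth_const_ge0 // lerD2l ler_wpM2r ?invr_ge0 // lerD2r.
  by rewrite ler_nat ltnW.
have g2 : `|min_cost E (initial_points (sample_size d j)) - Lg| <= a * e'.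
  apply: le_trans h2 _.
  have -> : (sample_size d j)%:R * (k%:R ^+ 2 * (2 * (d.+1%:R / (resolution j)%:R))) =
     (k%:R ^+ 2 * (2 * d.+1%:R)) * ((sample_size d j)%:R / (resolution j)%:R) :> R by ring.
  apply: (@le_trans _ _ (k%:R ^+ 2 * (2 * d.+1%:R) * (a / j%:R))).
    by rewrite ler_wpM2l // mulr_ge0 ?sqr_ge0.
  by rewrite mulrCA ler_wpM2l // ltW.
have g3 : `|m - a * b| <= a * e'.
  have -> : m - a * b = a * (m / a - b) by field; rewrite gt_eqF.
  by rewrite normrM (gtr0_norm ap) ler_wpM2l // ltW.
have g4 : `|b * (y - a)| <= a * e'.
  rewrite normrM [ `|y - a| ]ger0_norm ?subr_ge0 //.
  apply: (@le_trans _ _ (`|b| * (2 ^+ (2 * d) * a / j%:R))).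
    by rewrite ler_wpM2l // lerBlDl (le_trans a2).
  have -> : `|b| * (2 ^+ (2 * d) * a / j%:R) = a * (`|b| * 2 ^+ (2 * d) / j%:R) by ring.
  by rewrite ler_wpM2l // ltW.
have -> : min_cost E (initial_points n) / y - b = (min_cost E (initial_points n) - b * y) / y by field; rewrite gt_eqF.
rewrite normrM [ `|y^-1| ]gtr0_norm ?invr_gt0 // ler_pdivrMr //.
have : a * e <= e * y by rewrite [leLHS]mulrC ler_wpM2l // ltW.
have -> : a * e = 6 * (a * e') by rewrite /e'; field.
move: g1 g2 g3 g4 hJ2; rewrite [e' * a]mulrC !ler_norml.
move=> /andP[? ?] /andP[? ?] /andP[? ?] /andP[? ?] /andP[? ?] ?.
have : 0 < a * e' by rewrite mulr_gt0.
by move=> ?; apply/andP; split; lra.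
Qed.
End Interpolation.

Section Sampling.
Variables (R : realType) (disp : measure_display) (Omega : measurableType disp).
Variables (P : probability Omega R) (d : nat).
Variable x : nat -> {RV P >-> d.+1.-tuple R}.
Hypotheses (hindep : mutually_independent x)
  (hunif : forall i, uniform_on_cube (x i)).
Local Notation pt := (d.+1.-tuple R).
Local Notation grid N := {ffun 'I_d.+1 -> 'I_N}.

Lemma uniform_prob_itv (a b : R) : 0 <= a -> a <= b -> b <= 1 ->
  uniform_prob (@ltr01 R) `[a, b] = (b - a)%:E.
Proof.
move=> a0 ab b1; rewrite /uniform_prob (eq_integral (fun=> 1%:E)); last first.
  move=> y; rewrite inE /= in_itv /= /uniform_pdf => /andP[ay yb].
  by rewrite (le_trans a0 ay) (le_trans yb b1) subr0 invr1.
rewrite integral_cst //= mul1e lebesgue_measure_itv /= lte_fin.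
by move: ab; rewrite le_eqVlt => /predU1P[->|->]; rewrite ?ltxx ?subrr.
Qed.

(** Closed cells overlap on their boundaries. This is harmless: they are only required to cover the
    cube, and probabilities of unions are only bounded above. *)
Definition closed_cell N (g : grid N) : set pt :=
  [set t | forall j, [set` `[(g j)%:R / N%:R, ((g j)%:R + 1) / N%:R]] (tnth t j)].

Lemma measurable_closed_cell N (g : grid N) : measurable (closed_cell g).
Proof.
have -> : closed_cell g = \bigcap_(j in [set: 'I_d.+1])
    ([set: pt] `&` (@tnth _ R ^~ j) @^-1` [set` `[(g j)%:R / N%:R, ((g j)%:R + 1) / N%:R]]).
  by apply/seteqP; split => t /= h j; [move=> _; split => //; exact: h | case: (h j Logic.I)].
apply: fin_bigcap_measurable; first exact: finite_finset.
by move=> j _; apply: measurable_tnth => //; exact: measurable_itv.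
Qed.

Lemma P_closed_cell i N (g : grid N) : (0 < N)%N ->
  P (x i @^-1` closed_cell g) = ((N%:R^-1 : R) ^+ d.+1)%:E.
Proof.
move=> N0; have Np : 0 < N%:R :> R by rewrite ltr0n.
have := hunif i (B := fun j => [set` `[(g j)%:R / N%:R, ((g j)%:R + 1) / N%:R]])
  (fun j => measurable_itv _).
rewrite /distribution /= /pushforward => ->.
rewrite (eq_bigr (fun=> (N%:R^-1)%:E)); last first.
  move=> j _; rewrite uniform_prob_itv ?divr_ge0 //.
  - by congr (_%:E); rewrite -mulrBl addrAC subrr add0r mul1r.
  - by rewrite ler_wpM2r ?invr_ge0 // lerDl.
  - by rewrite ler_pdivrMr // mul1r natr1 ler_nat.
by rewrite prodEFin prodr_const card_ord.
Qed.

Lemma incube_ae : \forall w \ae P, forall i, incube (x i w).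
Proof.
apply: ae_foralln => i.
have N1 : (0 < 1)%N by [].
(* The single cell of the grid of resolution 1 is the whole cube. *)
pose g : grid 1 := [ffun=> ord0].
have hP := P_closed_cell i g N1.
have mA : measurable (x i @^-1` closed_cell g).
  by rewrite -[_ @^-1` _]setTI; apply: measurable_funP => //; exact: measurable_closed_cell.
exists (~` (x i @^-1` closed_cell g)); split.
- exact: measurableC.
- apply: (etrans (probability_setC P mA)).
  by rewrite hP invr1 expr1n -EFinB subrr.
- move=> w; apply: contra_not => /= h; apply/forallP => j.
  by have := h j; rewrite /= ffunE in_itv /= mul0r add0r divr1.
Qed.

Lemma P_cells N (g : seq (grid N)) (g0 : grid N) : (0 < N)%N ->
  P (\bigcap_(i in [set` [fset i | i in iota 0 (size g)]%fset])
       x i @^-1` closed_cell (nth g0 g i)) =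
  ((#|grid N|%:R^-1 : R) ^+ size g)%:E.
Proof.
move=> N0.
rewrite (@hindep _ (fun i => closed_cell (nth g0 g i))); last first.
  by move=> i; exact: measurable_closed_cell.
rewrite (eq_bigr (fun=> ((N%:R^-1 : R) ^+ d.+1)%:E)); last first.
  by move=> i _; rewrite P_closed_cell.
rewrite prodEFin big_const_seq count_predT iter_mulr_1.
rewrite card_fseq undup_id ?iota_uniq // size_iota.
by rewrite card_grid natrX exprVn.
Qed.
End Sampling.

(** * From averages over words to almost sure statements *)

Section BorelCantelli.
Variables (R : realType) (disp : measure_display) (Omega : measurableType disp).
Variables (P : probability Omega R) (d : nat).
Variable x : nat -> {RV P >-> d.+1.-tuple R}.
Hypotheses (hindep : mutually_independent x)
  (hunif : forall i, uniform_on_cube (x i)).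
Local Notation grid N := {ffun 'I_d.+1 -> 'I_N}.

Definition cylinder N (g0 : grid N) (g : seq (grid N)) : set Omega :=
  \bigcap_(i in [set` [fset i | i in iota 0 (size g)]%fset])
       x i @^-1` closed_cell (nth g0 g i).

(** A measurable event containing, for points in the cube, the event that the word of their cells
    satisfies [A]; its probability is at most the finite average of [A]. *)
Definition hits N (g0 : grid N) n (A : pred (seq (grid N))) : set Omega :=
  \big[setU/set0]_(t : n.-tuple (grid N) | A t) cylinder g0 t.

Lemma measurable_cylinder N (g0 : grid N) g : measurable (cylinder g0 g).
Proof.
apply: fin_bigcap_measurable; first exact: finite_fset.
move=> i _; rewrite -[_ @^-1` _]setTI.
by apply: measurable_funP => //; exact: measurable_closed_cell.
Qed.

Lemma measurable_hits N (g0 : grid N) n A : measurable (hits g0 n A).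
Proof. by apply: bigsetU_measurable => t _; exact: measurable_cylinder. Qed.

Lemma P_hits_le N (g0 : grid N) n (A : pred (seq (grid N))) : (0 < N)%N ->
  (P (hits g0 n A) <= (expect n (fun s => (A s)%:R : R))%:E)%E.
Proof.
move=> N0; rewrite expect_tuple.
apply: (@le_trans _ _ (\sum_(t : n.-tuple (grid N) | A t) P (cylinder g0 t))%E).
  rewrite /hits; elim: (index_enum _) => [|t r IH].
    by rewrite !big_nil measure0.
  rewrite !big_cons; case: ifP => // At.
  apply: le_trans (measureU2 _ _ _) _.
  - exact: measurable_cylinder.
  - by apply: bigsetU_measurable => t' _; exact: measurable_cylinder.
  - by rewrite leeD2l.
rewrite (eq_bigr (fun=> ((#|grid N|%:R^-1 : R) ^+ n)%:E)); last first.
  by move=> t _; rewrite /cylinder P_cells // size_tuple.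
rewrite sumEFin lee_fin big_mkcond /= mulr_suml; apply: ler_sum => t _.
by rewrite exprVn; case: (A t); rewrite ?mul1r ?mul0r.
Qed.

Lemma mem_hits N (N0 : (0 < N)%N) (g0 : grid N) n (A : pred (seq (grid N))) w :
  (forall i, incube (x i w)) -> A (cells (fun i => x i w) N0 n) ->
  hits g0 n A w.
Proof.
move=> cw Ac; have hsz : size (cells (fun i => x i w) N0 n) == n.
  by rewrite size_map size_initial_points.
rewrite /hits (bigD1 (Tuple hsz)) //=; left => i /=.
rewrite inE /= mem_iota (eqP hsz) => /andP[_ hi] j.
rewrite /cells (nth_map (origin R _)) ?size_initial_points // /initial_points (nth_map 0%N) ?size_iota //.
rewrite nth_iota // add0n ffunE /= in_itv /=.
exact: cell_index_bounds.
Qed.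

Lemma sum_inv_sqr_le n : \sum_(0 <= i < n) (i.+1%:R ^+ 2)^-1 <= 2 :> R.
Proof.
(* Telescoping: 1/(y+1)^2 is at most 1/y - 1/(y+1). *)
suff h m : \sum_(0 <= i < m.+1) (i.+1%:R ^+ 2)^-1 <= 2 - m.+1%:R^-1 :> R.
  case: n => [|n]; first by rewrite big_nil.
  by apply: le_trans (h n) _; rewrite gerBl invr_ge0.
elim: m => [|m IH]; first by rewrite big_nat1 expr1n invr1; lra.
rewrite big_nat_recr //=; apply: le_trans (lerD IH (lexx _)) _.
rewrite -[m.+2%:R]natr1; have : 0 < m.+1%:R :> R by rewrite ltr0n.
move: (m.+1%:R : R) => y y0.
suff : ((y + 1) ^+ 2)^-1 <= y^-1 - (y + 1)^-1.
  by set u := (_ ^+ 2)^-1; set v := (y + 1)^-1; set z := y^-1; lra.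
have y1 : 0 < y + 1 by rewrite addr_gt0.
have -> : y^-1 - (y + 1)^-1 = (y * (y + 1))^-1.
  by field; rewrite (gt_eqF y0) (gt_eqF y1).
rewrite lef_pV2 ?posrE ?exprn_gt0 ?mulr_gt0 //.
by rewrite expr2 ler_wpM2r ?(ltW y1) // lerDl.
Qed.

Lemma grid_borel_cantelli (n : nat -> nat) (A : forall j, pred (seq (grid (resolution j))))
    (C : R) J : 0 <= C ->
  (forall j, (J <= j)%N -> (0 < j)%N ->
    expect (n j) (fun s => (A j s)%:R : R) <= C / j%:R ^+ 2) ->
  \forall w \ae P, exists J', forall j, (J' <= j)%N ->
    forall N0 : (0 < resolution j)%N, ~~ A j (cells (fun i => x i w) N0 (n j)).
Proof.
move=> C0 hA.
(* The shift passes the threshold [J], keeps the resolution positive, and gives the i-th event a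
   probability of at most C/(i+1)^2. *)
pose jj i := (i + J).+1.
pose N0 i : (0 < resolution (jj i))%N := resolution_gt0 (ltn0Sn (i + J)).
pose g0 i : grid (resolution (jj i)) := [ffun=> Ordinal (N0 i)].
pose F i := hits (g0 i) (n (jj i)) (A (jj i)).
have mF i : measurable (F i) by exact: measurable_hits.
have PF i : (P (F i) <= (C * (i.+1%:R ^+ 2)^-1)%:E)%E.
  apply: le_trans (P_hits_le _ _ _ (N0 i)) _; rewrite lee_fin.
  apply: le_trans (hA (jj i) _ _) _ => //; first by rewrite /jj; lia.
  rewrite ler_wpM2l // lef_pV2 ?posrE ?exprn_gt0 ?ltr0n //.
  by rewrite lerXn2r ?nnegrE // ler_nat /jj; lia.
have sumF : (\sum_(i <oo) P (F i) < +oo)%E.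
  apply: (@le_lt_trans _ _ ((C * 2)%:E)); last exact: ltry.
  apply: lime_le; first by apply: is_cvg_nneseries => i _ _; exact: measure_ge0.
  apply: nearW => m.
  apply: (@le_trans _ _ (\sum_(0 <= i < m) (C * (i.+1%:R ^+ 2)^-1)%:E)%E).
    exact: lee_sum.
  by rewrite sumEFin lee_fin -mulr_sumr ler_wpM2l // sum_inv_sqr_le.
have h0 : P (lim_sup_set F) = 0%E by exact: lim_sup_set_cvg0.
have [W [mW PW hW]] := incube_ae hunif.
have mlim : measurable (lim_sup_set F).
  by apply: bigcapT_measurable => m; apply: bigcup_measurable => i _.
exists (W `|` lim_sup_set F); split.
- exact: measurableU.
- apply/eqP; rewrite eq_le measure_ge0 andbT.
  have <- : (P W + P (lim_sup_set F) = 0)%E by rewrite h0 adde0; exact: PW.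
  exact: measureU2.
move=> w; apply: contra_notP => /not_orP[Ww Fw].
have cw : forall i, incube (x i w).
  by apply: contra_notP Ww => h; apply: hW.
have [m hm] : exists m, forall i, (m <= i)%N -> ~ F i w.
  apply: contra_notP Fw => h m _; apply: contra_notP h => h.
  by exists m => i mi Fi; apply: h; exists i.
exists (m + J).+1 => j hj N0j; apply/negP => Aj.
have e : j = jj (j - J.+1)%N by rewrite /jj; lia.
apply: (hm (j - J.+1)%N); first by lia.
rewrite /F /g0; move: (N0 (j - J.+1)%N); rewrite -e => N0'.
exact: (@mem_hits _ N0j _ _ _ _ cw Aj).
Qed.
End BorelCantelli.

(** * Graphs and factors of finite sets *)

Lemma set2_inj (V : finType) (a b c c' : V) : [set a; b]%SET = [set c; c']%SET ->
  (a = c /\ b = c') \/ (a = c' /\ b = c).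
Proof.
move=> h.
have /set2P ha : a \in [set c; c']%SET by rewrite -h set21.
have /set2P hb : b \in [set c; c']%SET by rewrite -h set22.
have /set2P hc : c \in [set a; b]%SET by rewrite h set21.
have /set2P hc' : c' \in [set a; b]%SET by rewrite h set22.
by move: ha hb hc hc' {h}; intuition congruence.
Qed.

Lemma nth_map_enum (n : nat) (T : Type) (x0 : T) (g : 'I_n -> T) (u : 'I_n) :
  nth x0 [seq g v | v <- enum 'I_n] u = g u.
Proof. by rewrite (nth_map u) ?size_enum_ord // nth_ord_enum. Qed.

(** * Factors as edge sets and factors as lists of chunks *)

Section Bridge.
Variables (R : realType) (d k : nat) (E : rel 'I_k).
Hypotheses (E_sym : symmetric E) (E_irr : irreflexive E) (k_gt0 : (0 < k)%N).
Local Notation pt := (d.-tuple R).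

Definition ord_graph : sgraph := SGraph E_sym E_irr.

Variable X : {fset pt}.
Let m := (#|` X| %/ #|vertex ord_graph|)%N.
Let mH := copies m ord_graph.

Let mE : m = (#|` X| %/ k)%N.
Proof. by rewrite /m card_ord. Qed.

Let T : {set 'I_m * ('I_k * 'I_k)} :=
  [set t : 'I_m * ('I_k * 'I_k) | (t.2.1 < t.2.2)%N && E t.2.1 t.2.2]%SET.
Let e (t : 'I_m * ('I_k * 'I_k)) : {set vertex mH} :=
  [set (t.1, t.2.1); (t.1, t.2.2)]%SET.

Let edgesE : edges mH = (e @: T)%SET.
Proof.
apply/setP => s; rewrite inE; apply/idP/imsetP.
  move=> /existsP[p /existsP[q /andP[/andP[/eqP pq Epq] /eqP ->]]].
  case: p q pq Epq => i u [i' v] /= <- Euv.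
  have [uv|vu|uv] := ltngtP u v.
  - by exists (i, (u, v)) => //; rewrite inE uv.
  - exists (i, (v, u)); last exact: finset.setUC.
    by rewrite inE /= vu E_sym; exact: Euv.
  - have e' : u = v by exact: val_inj.
    by move: Euv; rewrite e' /= E_irr.
move=> [[i [u v]]]; rewrite inE => /andP[_ Euv] ->.
apply/existsP; exists (i, u); apply/existsP; exists (i, v).
apply/andP; split; last exact: eqxx.
by apply/andP; split; [exact: eqxx | exact: Euv].
Qed.

Let e_inj : {in T &, injective e}.
Proof.
move=> [i [u v]] [i' [u' v']]; rewrite !inE /= => /andP[uv _] /andP[uv' _].
move=> /set2_inj [[[-> ->] [->]]//|[[_ e1] [_ e2]]].
by move: uv uv'; rewrite e1 e2; lia.
Qed.

Lemma edge_length_set2 (a b : X) :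
  edge_length [set a; b]%SET = eucl_dist (val a) (val b).
Proof.
apply/le_anti/andP; split; rewrite /edge_length.
  apply: bigmax_le; first exact: eucl_dist_ge0.
  move=> [y z]; rewrite !inE /= => /andP[/orP[]/eqP-> /orP[]/eqP->];
    rewrite ?eucl_distxx ?eucl_dist_ge0 //.
  by rewrite eucl_distC.
apply: (@le_bigmax_cond _ _ _ _ (a, b) _ (fun p : X * X => eucl_dist (val p.1) (val p.2))).
by rewrite !inE !eqxx orbT.
Qed.

Definition chunks_of (f : vertex mH -> X) : seq (seq pt) :=
  [seq [seq val (f (i, u)) | u <- enum 'I_k] | i <- enum 'I_m].

Lemma total_length_chunks (f : vertex mH -> X) : injective f ->
  total_length [set f @: e | e : {set vertex mH} in edges mH]%SET =
  total_cost E (chunks_of f).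
Proof.
move=> f_inj; rewrite /total_length big_imset /=; last first.
  by move=> A B _ _; apply: imset_inj.
rewrite edgesE big_imset //=.
have hc (i : 'I_m) : chunk_cost E [seq val (f (i, u)) | u <- enum 'I_k] =
    \sum_(p : 'I_k * 'I_k | (p.1 < p.2)%N && E p.1 p.2)
      eucl_dist (val (f (i, p.1))) (val (f (i, p.2))).
  apply: eq_bigr => -[u v] _.
  by congr eucl_dist; apply: (nth_map_enum _ (fun w => val (f (i, w)))).
rewrite /total_cost /chunks_of big_map big_enum (eq_bigr _ (fun i _ => hc i)).
rewrite (eq_bigr (fun t : 'I_m * ('I_k * 'I_k) =>
    eucl_dist (val (f (t.1, t.2.1))) (val (f (t.1, t.2.2))))); last first.
  by move=> t _; rewrite /e imsetU1 imset_set1 edge_length_set2.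
rewrite (eq_bigl (fun t : 'I_m * ('I_k * 'I_k) =>
    xpredT t.1 && ((t.2.1 < t.2.2)%N && E t.2.1 t.2.2))); last first.
  by move=> t; rewrite inE.
rewrite -(pair_big xpredT (fun p : 'I_k * 'I_k => (p.1 < p.2)%N && E p.1 p.2)
   (fun i p => eucl_dist (val (f (i, p.1))) (val (f (i, p.2))))) /=.
by [].
Qed.

Let flatten_chunks (f : vertex mH -> X) :
  flatten (chunks_of f) = map (fun p => val (f p))
    [seq (i, u) | i <- enum 'I_m, u <- enum 'I_k].
Proof.
rewrite map_flatten -map_comp; congr flatten; apply: eq_map => i /=.
by rewrite -map_comp.
Qed.

(** The points missed by the embedding are the uncovered ones; their number is the remainder of |X|
    modulo k. *)
Lemma factor_costs_chunks (f : vertex mH -> X) : injective f ->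
  factor_costs E (enum_fset X) (total_cost E (chunks_of f)).
Proof.
move=> f_inj; set l := flatten (chunks_of f).
have ul : uniq l.
  rewrite /l flatten_chunks map_inj_uniq; last by move=> p q /val_inj/f_inj.
  by apply: allpairs_uniq; rewrite ?enum_uniq // => -[? ?] [? ?].
have sl : size l = (m * k)%N.
  by rewrite /l flatten_chunks size_map size_allpairs !size_enum_ord.
have lX : {subset l <= enum_fset X}.
  by move=> y; rewrite /l flatten_chunks => /mapP[p _ ->]; apply: valP.
exists (chunks_of f), [seq y <- enum_fset X | y \notin l].
have pX : perm_eq (enum_fset X) (l ++ [seq y <- enum_fset X | y \notin l]).
  apply: uniq_perm; first exact: fset_uniq.
    rewrite cat_uniq ul filter_uniq ?fset_uniq // andbT.
    by apply/hasPn => y; rewrite mem_filter => /andP[].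
  move=> y; rewrite mem_cat mem_filter.
  by case: (boolP (y \in l)) => //= /lX ->.
split=> //.
  by apply/allP => c /mapP[i _ ->]; rewrite size_map size_enum_ord.
have := perm_size pX; rewrite size_cat sl mE {1}(divn_eq (size (enum_fset X)) k).
by move=> /addnI <-; rewrite ltn_mod.
Qed.

Lemma nth_flatten_uniform (V : Type) (x0 : V) (cs : seq (seq V)) i u :
  all (fun c => size c == k) cs -> (i < size cs)%N -> (u < k)%N ->
  nth x0 (flatten cs) (i * k + u) = nth x0 (nth [::] cs i) u.
Proof.
elim: cs i => //= c cs IH [|i] /andP[/eqP hc hcs] hi hu; rewrite nth_cat hc.
  by rewrite mul0n add0n hu.
by rewrite mulSn -addnA ltnNge leq_addr /= addKn IH.
Qed.

(** Fewer than k uncovered points force exactly |X| %/ k chunks. Vertex u of copy i goes to position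
    i k + u of the flattened list, whose entries are distinct because [X] is a set. *)
Lemma chunks_factor_costs c : factor_costs E (enum_fset X) c ->
  exists2 f : vertex mH -> X, injective f & c = total_cost E (chunks_of f).
Proof.
move=> [cs [rest [h1 h2 h3 ->]]].
have sf : size (flatten cs) = (size cs * k)%N by exact: size_flatten_chunks.
have mcs : size cs = m.
  rewrite mE -[#|` X|]/(size (enum_fset X)) (perm_size h1) size_cat sf.
  by rewrite divnMDl // (divn_small h3) addn0.
have sz (i : 'I_m) : size (nth [::] cs i) = k.
  by apply/eqP/(allP h2)/mem_nth; rewrite mcs.
have pos (p : vertex mH) : (p.1 * k + p.2 < size (flatten cs))%N.
  rewrite sf mcs; apply: (@leq_trans (p.1.+1 * k)); last by rewrite leq_mul2r ltn_ord orbT.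
  by rewrite mulSn addnC ltn_add2r.
have nf (p : vertex mH) : nth (origin R d) (flatten cs) (p.1 * k + p.2) =
    nth (origin R d) (nth [::] cs p.1) p.2.
  by apply: nth_flatten_uniform => //; rewrite mcs.
have memX (p : vertex mH) : nth (origin R d) (nth [::] cs p.1) p.2 \in X.
  rewrite -[_ \in X]/(_ \in enum_fset X) (perm_mem h1) mem_cat -nf mem_nth //.
pose f (p : vertex mH) : X := [` memX p]%fset.
have uf : uniq (flatten cs).
  by have := fset_uniq X; rewrite (perm_uniq h1) cat_uniq => /and3P[].
exists f.
  move=> [i u] [i' u'] /(congr1 val) /=.
  rewrite -(nf (i, u)) -(nf (i', u')) => /eqP; rewrite nth_uniq ?pos //= => /eqP h.
  have hi : i = i'.
    apply: val_inj => /=; have := congr1 (divn^~ k) h.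
    by rewrite !divnMDl // !divn_small ?ltn_ord // !addn0.
  congr (_, _) => //; apply: val_inj => /=; have := congr1 (modn^~ k) h.
  by rewrite !modnMDl !modn_small ?ltn_ord.
congr total_cost; apply: (@eq_from_nth _ [::]).
  by rewrite size_map size_enum_ord.
move=> i; rewrite mcs => hi.
rewrite [RHS](nth_map_enum _ (fun i => [seq val (f (i, u)) | u <- enum 'I_k]) (Ordinal hi)).
apply: (@eq_from_nth _ (origin R d)).
  by rewrite size_map size_enum_ord (sz (Ordinal hi)).
move=> u; rewrite (sz (Ordinal hi)) => hu.
by rewrite [RHS](nth_map_enum _ (fun u => val (f (Ordinal hi, u))) (Ordinal hu)).
Qed.

Lemma HF_min_cost : HF ord_graph X = min_cost E (enum_fset X).
Proof.
congr inf; apply/seteqP; split=> c.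
  move=> [F [f f_inj ->] <-]; rewrite total_length_chunks //.
  exact: factor_costs_chunks.
move=> /chunks_factor_costs [f f_inj ->]; rewrite -total_length_chunks //.
by exists [set f @: e | e : {set vertex mH} in edges mH]%SET => //; exists f.
Qed.
End Bridge.

Section AlmostSure.
Variables (R : realType) (disp : measure_display) (Omega : measurableType disp).
Variables (P : probability Omega R) (d : nat).
Variable x : nat -> {RV P >-> d.+1.-tuple R}.
Hypotheses (hindep : mutually_independent x)
  (hunif : forall i, uniform_on_cube (x i)) (d_gt0 : (0 < d)%N).

Let pts w i := x i w.

(** Equal points have equal cells, and almost surely all cells are distinct for large [j]. This is
    needed because [points] is a finite set, in which repetitions would collapse. *)
Lemma uniq_initial_points_ae : \forall w \ae P, forall n, uniq (initial_points (pts w) n).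
Proof.
have hA j : (0 <= j)%N -> (0 < j)%N ->
    expect (sample_size d j) (fun s : seq {ffun 'I_d.+1 -> 'I_(resolution j)} => (~~ uniq s)%:R : R)
    <= 1 / j%:R ^+ 2.
  move=> _ j0; apply: le_trans (expect_not_uniq _ (card_grid_gt0 d (resolution_gt0 j0)) _) _.
  rewrite card_grid /sample_size /resolution !natrX -!exprM mul1r.
  rewrite ler_pdivrMr ?exprn_gt0 ?ltr0n // ler_pdivlMl ?exprn_gt0 ?ltr0n //.
  rewrite -exprD; apply: ler_weXn2l; [by rewrite ler1n | lia].
have := grid_borel_cantelli hindep hunif ler01 hA.
apply: filterS => w [J hJ] n.
pose j := maxn J (maxn n 1).
have j0 : (0 < j)%N by rewrite /j; lia.
have /hJ /(_ (resolution_gt0 j0)) : (J <= j)%N by rewrite /j; lia.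
rewrite negbK => /map_uniq.
have nj : (n <= sample_size d j)%N.
  apply: (@leq_trans j); first by rewrite /j; lia.
  by rewrite /sample_size -[X in (X <= _)%N]expn1 leq_pexp2l.
rewrite /initial_points -(subnKC nj) iotaD map_cat cat_uniq.
by case/andP.
Qed.

Lemma tends_cvgn (u : nat -> R) l : tends u l -> u n @[n --> \oo] --> l.
Proof.
move=> h; apply/cvgrPdist_le => e e0; have [J hJ] := h e e0.
by exists J => // n /= Jn; rewrite distrC hJ.
Qed.

Lemma is_beta_scaled_mean (k : nat) (E : rel 'I_k) (E_sym : symmetric E)
    (E_irr : irreflexive E) (b : R) : (0 < k)%N ->
  tends (scaled_mean R d E) b -> is_beta x (ord_graph E_sym E_irr) b.
Proof.
move=> k_gt0 gamb.
(* Tolerances 1/(m+1) suffice, so only countably many almost sure events are intersected. *)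
have hconc : \forall w \ae P, forall m, exists J, forall j, (J <= j)%N ->
    forall N0 : (0 < resolution j)%N,
    `|grid_cost R E (cells (pts w) N0 (sample_size d j)) - sample_mean R d E j| <=
      m.+1%:R^-1 * j%:R ^+ (2 * d).
  apply: ae_foralln => m.
  have e0 : 0 < m.+1%:R^-1 :> R by rewrite invr_gt0.
  have [C C0 [J J0 hC]] := grid_cost_concentration E k_gt0 d_gt0 e0.
  have hA j : (J <= j)%N -> (0 < j)%N ->
      expect (sample_size d j) (fun s : seq {ffun 'I_d.+1 -> 'I_(resolution j)} =>
        (m.+1%:R^-1 * j%:R ^+ (2 * d) < `|grid_cost R E s - sample_mean R d E j|)%R%:R : R)
      <= C / j%:R ^+ 2.
    by move=> Jj _; apply: hC.
  have := grid_borel_cantelli hindep hunif C0 hA.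
  apply: filterS => w [J' hJ']; exists J' => j hj N0.
  by have := hJ' j hj N0; rewrite -leNgt.
suff main w : (forall m, exists J, forall j, (J <= j)%N ->
      forall N0 : (0 < resolution j)%N,
      `|grid_cost R E (cells (pts w) N0 (sample_size d j)) - sample_mean R d E j| <=
        m.+1%:R^-1 * j%:R ^+ (2 * d)) ->
    (forall n, uniq (initial_points (pts w) n)) -> (forall i, incube (x i w)) ->
    HF (ord_graph E_sym E_irr) (points x n w) /
      (n%:R `^ (d.+1.-1%:R / d.+1%:R)) @[n --> \oo] --> b.
  exact: (filterS3 _ main hconc uniq_initial_points_ae (incube_ae hunif)).
move=> hc hu hcube; apply: tends_cvgn.
have -> : (fun n => HF (ord_graph E_sym E_irr) (points x n w) /
      (n%:R `^ (d.+1.-1%:R / d.+1%:R))) =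
    (fun n => min_cost E (initial_points (pts w) n) / (n%:R `^ (d%:R / d.+1%:R))).
  apply/funext => n; congr (_ / _); rewrite HF_min_cost //; apply: min_cost_perm.
  apply: uniq_perm; [exact: fset_uniq | exact: hu | move=> y].
  rewrite -[y \in enum_fset _]/(y \in points x n w).
  apply/imfsetP/mapP => /= [[i _ ->]|[i]].
    by exists (nat_of_ord i) => //; rewrite mem_iota /= add0n.
  by rewrite mem_iota add0n => /andP[_ hi] ->; exists (Ordinal hi).
apply: min_cost_tends => // e e0.
have [J hJ] := hc (Num.truncn (e^-1)).
exists J => j Jj N0; apply: le_trans (hJ j Jj N0) _.
rewrite ler_wpM2r ?exprn_ge0 // invf_ple ?posrE ?invr_gt0 //.
by rewrite ltW // truncnS_gt.
Qed.
End AlmostSure.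

(** * Infinitely many constants *)

Lemma intermediate_set (T : finType) (A B : {set T}) n : A \subset B ->
  (#|A| <= n <= #|B|)%N -> exists C : {set T}, [/\ A \subset C, C \subset B & #|C| = n].
Proof.
move=> AB /andP[]; elim: n => [|n IH] An nB.
  by exists A; split=> //; apply/eqP; rewrite -leqn0.
move: An; rewrite leq_eqVlt => /predU1P[<-|An]; first by exists A.
have [C [AC CB Cn]] := IH An (ltnW nB).
have /properP[_ [y yB yC]] : C \proper B by rewrite properEcard CB Cn.
exists (y |: C)%SET; split; last by rewrite cardsU1 yC Cn.
  by apply: fintype.subset_trans AC _; apply: finset.subsetUr.
by rewrite finset.subUset finset.sub1set yB.
Qed.

(** The edge set is any family of [e] pairs between the star at [ord0] and the set of all pairs. *)
Lemma star_graph (k' e : nat) : (k' <= e)%N -> (e <= 'C(k'.+1, 2))%N ->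
  exists (E : rel 'I_k'.+1) (E_sym : symmetric E) (E_irr : irreflexive E),
    (forall v, v != ord0 -> E ord0 v) /\ #|edges (ord_graph E_sym E_irr)| = e.
Proof.
move=> ke ek.
pose S : {set {set 'I_k'.+1}} := [set [set ord0; lift ord0 i] | i : 'I_k']%SET.
pose B : {set {set 'I_k'.+1}} := [set s : {set 'I_k'.+1} | #|s| == 2]%SET.
have SB : S \subset B.
  by apply/fintype.subsetP => s /imsetP[i _ ->]; rewrite inE cards2.
have cS : #|S| = k'.
  rewrite card_imset ?card_ord // => i j /set2_inj [[_]|[h _]].
    exact: lift_inj.
  by have := neq_lift ord0 j; rewrite -h eqxx.
have cB : #|B| = 'C(k'.+1, 2) by rewrite /B card_draws card_ord.
have [|M [SM MB Me]] := @intermediate_set _ S B e SB; first by rewrite cS cB ke.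
pose E := [rel u v : 'I_k'.+1 | [set u; v]%SET \in M].
have E_sym : symmetric E by move=> u v; rewrite /E /= finset.setUC.
have E_irr : irreflexive E.
  move=> u; apply/negP => /(fintype.subsetP MB); rewrite inE finset.setUid cards1 //.
exists E, E_sym, E_irr; split.
  move=> v; case: (unliftP ord0 v) => [i ->|-> //] _.
  by apply: (fintype.subsetP SM); apply/imsetP; exists i.
rewrite -Me; congr #|pred_of_set _|; apply/setP => s; rewrite inE.
apply/idP/idP.
  by move=> /existsP[u /existsP[v /andP[uv /eqP ->]]]; exact: uv.
move=> sM; have sB := fintype.subsetP MB _ sM.
have s2 : #|s| == 2 by move: sB; rewrite inE.
have /cards2P[u [v [uv sE]]] := s2.
apply/existsP; exists u; apply/existsP; exists v.
by apply/andP; split; [rewrite /= -sE | rewrite sE eqxx].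
Qed.

Lemma star_connected (k' : nat) (E : rel 'I_k'.+1) (E_sym : symmetric E)
    (E_irr : irreflexive E) : (forall v, v != ord0 -> E ord0 v) ->
  connected_graph (ord_graph E_sym E_irr).
Proof.
move=> hE; split; first by rewrite card_ord.
have h0 (v : 'I_k'.+1) : connect E ord0 v.
  have [->|/hE v0] := eqVneq v ord0; first exact: connect0.
  exact: connect1.
move=> u v; apply: (connect_trans (y := ord0)); last exact: h0.
by have := h0 u; rewrite (sym_connect_sym E_sym).
Qed.

(** For r = a/q take q l vertices and a l edges. As r >= 1, there are enough edges for a star; as q
    l > 2 a, they fit into the complete graph. *)
Lemma density_sizes (r : rat) (K : nat) : 1 <= r -> exists k' e,
  [/\ (K <= k'.+1)%N, (k' <= e)%N, (e <= 'C(k'.+1, 2))%N &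
      e%:R / k'.+1%:R = r].
Proof.
move=> r1.
have n0 : 0 <= numq r by rewrite numq_ge0 (le_trans _ r1).
have rE : r = `|numq r|%N%:R / `|denq r|%N%:R.
  rewrite -{1}(divq_num_den r) !pmulrn !gez0_abs //.
set a := `|numq r|%N in rE; set q := `|denq r|%N in rE.
have q0 : (0 < q)%N by rewrite absz_gt0 denq_neq0.
have qa : (q <= a)%N.
  by move: r1; rewrite rE ler_pdivlMr ?ltr0n // mul1r ler_nat.
pose l := (K + 2 * a + 1)%N.
have ql0 : (0 < q * l)%N by rewrite muln_gt0 q0 /l addn1.
exists (q * l).-1, (a * l)%N; rewrite prednK //; split.
- by rewrite /l; nia.
- by rewrite /l; nia.
- rewrite bin2 geq_half_double -muln2.
  have : (2 * a + 1 <= q * l)%N by rewrite /l; nia.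
  have : (l <= q * l)%N by rewrite leq_pmull.
  case: (q * l)%N ql0 => // n _ /= ln; rewrite addn1 ltnS => an.
  by have := leq_mul ln an; lia.
- rewrite rE !natrM -mulf_div divff ?mulr1 // pnatr_eq0 /l addn1 //.
Qed.

Section Unbounded.
Variables (R : realType) (d : nat).
Hypothesis d_gt0 : (0 < d)%N.

Lemma unbounded_beta (r : rat) (b : nat) : 1 <= r -> (8 <= b)%N ->
  exists (k : nat) (E : rel 'I_k) (E_sym : symmetric E) (E_irr : irreflexive E)
      (l : R),
    [/\ (0 < k)%N, connected_graph (ord_graph E_sym E_irr),
        edge_density (ord_graph E_sym E_irr) = r,
        tends (scaled_mean R d E) l & b%:R / 4 <= l].
Proof.
move=> r1 b8.
have [k' [e [hk ke ek er]]] := density_sizes (4 * (1 + 3 ^ d.+1 * (2 * b ^ d.+1))) r1.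
have [E [E_sym [E_irr [hE eE]]]] := star_graph ke ek.
have k_gt0 : (0 < k'.+1)%N by [].
have [l hl] := scaled_mean_tends R E k_gt0 d_gt0.
exists k'.+1, E, E_sym, E_irr, l; split=> //.
- exact: star_connected.
- by rewrite /edge_density eE card_ord.
have bp : 0 < b%:R :> R by rewrite ltr0n; apply: leq_trans b8.
have e0 : 0 < b%:R / 8 :> R by rewrite divr_gt0.
have [J hJ] := hl _ e0.
(* The index [b * i] passes [J], and the correction k b / i falls below b/8. With the tolerance b/8
   for the limit, b/2 - b/8 - b/8 = b/4 remains. *)
pose i := (J + 8 * k'.+1)%N.
have i0 : (0 < i)%N by rewrite /i; lia.
have ip : 0 < i%:R :> R by rewrite ltr0n.
have /hJ : (J <= b * i)%N by rewrite /i; nia.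
have := scaled_mean_lower R hE b8 i0 hk.
have h : k'.+1%:R * b%:R / i%:R <= b%:R / 8 :> R.
  rewrite ler_pdivrMr // [leRHS]mulrAC ler_pdivlMr // -!natrM ler_nat /i; nia.
rewrite ler_norml => g1 /andP[g2 g3].
lra.
Qed.
End Unbounded.

Unset Implicit Arguments.

Theorem theorem1p7 (R : realType) (disp : measure_display)
    (Omega : measurableType disp) (P : probability Omega R) (d : nat)
    (x : nat -> {RV P >-> d.-tuple R}) (r : rat)
    (hd : (2 <= d)%N) (hr : 1 <= r)
    (hindep : mutually_independent x)
    (hunif : forall i, uniform_on_cube (x i)) :
  infinite_set [set b : R | exists H : sgraph,
    [/\ connected_graph H, edge_density H = r & is_beta x H b]].
Proof.
case: d x hd hindep hunif => // d x hd hindep hunif /finite_fsetP [X XE].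
(* If the set were finite, [B] would bound all its elements; [b] exceeds 4 B and is at least 8, so a
   constant of at least b/4 gives a contradiction. *)
pose B := \sum_(y <- enum_fset X) `|y|.
pose b := (Num.truncn (4 * B) + 8)%N.
have [|k [E [E_sym [E_irr [l [k_gt0 hc hden hl lb]]]]]] :=
    @unbounded_beta R d hd r b hr; first by rewrite /b leq_addl.
have lX : l \in X.
  suff : [set` X] l by [].
  rewrite -XE; exists (ord_graph E_sym E_irr); split=> //.
  exact: is_beta_scaled_mean.
have lB : l <= B.
  rewrite /B (big_rem l) //=; apply: le_trans (ler_norm l) _.
  by rewrite lerDl sumr_ge0.
have : 4 * B < b%:R.
  apply: lt_le_trans (truncnS_gt _) _; rewrite ler_nat.
  by rewrite /b -addn1 leq_add2l.
lra.
Qed.
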